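(* Let $p>1$ and let $t\mapsto u(t)\in V=H^1(\mathbb{R},\mathbb{C})$ be a $C^1$ curve, defined for $t$ in an open interval $I$. Then $u$ is a solution to $$ i u_t = -\tfrac12 \partial_x^2 u - |u|^{p-1}u $$ if and only if $$ (\dot u(t),1)\in \ker \widetilde\omega_{(u(t),t)} \quad\text{for all } t\in I .$$ In other words, for every $(u,t)\in \widetilde V=V\times\mathbb{R}$ for which $(\Xi_H)_u\in V$, $$\ker\widetilde\omega_{(u,t)}=\mathbb{R}\,\big((\Xi_H)_u,1\big).$$
   Context: $V=H^1(\mathbb{R},\mathbb{C})\subset L^2(\mathbb{R},\mathbb{C})$ is viewed as a real Hilbert space, with $$\langle u,v\rangle=\mathrm{Re}\int u\bar v\,dx,\qquad \omega(u,v)=\langle u,iv\rangle=\mathrm{Im}\int u\bar v\,dx .$$ The Hamiltonian is $H:V\to\mathbb{R}$, $H(u)=\int\left(\tfrac14|\partial_x u|^2-\tfrac1{p+1}|u|^{p+1}\right)dx$, with differential $d_uH(v)=dH_u(v)=\frac{d}{ds}\big|_{s=0}H(u+sv)=\mathrm{Re}\int\left(\tfrac12\partial_xu\,\partial_x\bar v-|u|^{p-1}u\,\bar v\right)dx$. Its Hamiltonian vector field $\Xi_H$ is defined by $\omega(v,(\Xi_H)_u)=d_uH(v)$ for all $v\in T_uV$, i.e. $(\Xi_H)_u=\frac1i\left(-\tfrac12\partial_x^2u-|u|^{p-1}u\right)$ (in general a distribution; as a tangent vector it is required to lie in $T_uV=V$). On $\widetilde V=V\times\mathbb{R}$, with $T_{(u,t)}\widetilde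 V$ identified with $V\times\mathbb{R}$, define the one-form $$\alpha_{(u,t)}(v,T)=\tfrac12\omega(u,v)-H(u)T$$ and $\widetilde\omega=d\alpha$, that is, $$\widetilde\omega_{(u,t)}((v_1,T_1),(v_2,T_2))=\omega(v_1,v_2)-dH_u(v_1)T_2+dH_u(v_2)T_1 .$$ Its kernel is $$\ker\widetilde\omega_{(u,t)}=\{(v,T)\in T_{(u,t)}\widetilde V:\ \widetilde\omega_{(u,t)}((v,T),(v',T'))=0\ \ \forall (v',T')\in T_{(u,t)}\widetilde V\}.$$ The differential equation for the $C^1$ curve $u$ is understood in the sense of distributions in $x$ for each $t$, with $u_t=\dot u$. *)

(* Defs.v *)
From HB Require Import structures.
From mathcomp Require Import all_boot all_order all_algebra.
From mathcomp Require Import all_classical all_reals all_analysis.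
From mathcomp Require Import complex.

Set Implicit Arguments.
Unset Strict Implicit.
Unset Printing Implicit Defensive.

Import Order.TTheory GRing.Theory Num.Theory.
Import numFieldNormedType.Exports.

Local Open Scope classical_set_scope.
Local Open Scope ring_scope.
Local Open Scope complex_scope.

(* Elements of L^2(R,C) and of V = H^1(R,C) are represented by functions
   R -> R[i] belonging to the sets [L2] and [H1] below; two representatives
   denote the same element when they are equal almost everywhere. *)

Section spaces.
Context {R : realType}.
Implicit Types (f g u v : R -> R[i]) (phi : R -> R).

Local Notation mu := (@lebesgue_measure R).
Local Notation reC := (@complex.Re R).
Local Notation imC := (@complex.Im R).

Definition Cintegral f : R[i] :=
  (\int[mu]_x reC (f x)) +i* (\int[mu]_x imC (f x)).

Definition iC : R[i] := 0 +i* 1.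

Definition addC_fun u v : R -> R[i] := fun x => u x + v x.
Definition scaleC_fun (a : R) u : R -> R[i] := fun x => a%:C * u x.

Definition L2 : set (R -> R[i]) :=
  [set f : R -> R[i] | (reC \o f) \in Lfun mu 2%:E /\
                      (imC \o f) \in Lfun mu 2%:E].

Definition test_function : set (R -> R) :=
  [set phi | (forall n x, derivable (derive1n n phi) x 1) /\
             compact (closure [set x | phi x != 0])].

(* A C-valued distribution is given by its values on real test functions; its
   values elsewhere are irrelevant. *)
Definition cdistribution : Type := (R -> R) -> R[i].

Definition eq_distr (S T : cdistribution) : Prop :=
  forall phi, test_function phi -> S phi = T phi.

Definition distr f : cdistribution :=
  fun phi => Cintegral (fun x => f x * (phi x)%:C).

Definition Ddistr (T : cdistribution) : cdistribution :=
  fun phi => - T (derive1 phi).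

Definition weak_derivative u g : Prop := eq_distr (Ddistr (distr u)) (distr g).

Definition H1 : set (R -> R[i]) :=
  [set u : R -> R[i] | L2 u /\ exists2 g, L2 g & weak_derivative u g].

(* A representative of the weak derivative in L^2. *)
Definition Dx u : R -> R[i] :=
  xget (fun=> 0) [set g : R -> R[i] | L2 g /\ weak_derivative u g].

Definition inner u v : R := reC (Cintegral (fun x => u x * conjc (v x))).

Definition omega u v : R := inner u (fun x => iC * v x).

Definition normV u : R := Num.sqrt (inner u u + inner (Dx u) (Dx u)).

(* [u] is a C^1 curve from the open set [I] to H1, with derivative [du]. *)
Definition C1_curve (I : set R) (u du : R -> R -> R[i]) : Prop :=
  [/\ forall t, I t -> H1 (u t),
      forall t, I t -> H1 (du t),
      forall t, I t ->
        normV (addC_fun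
          (scaleC_fun h^-1 (addC_fun (u (t + h)) (scaleC_fun (-1) (u t))))
          (scaleC_fun (-1) (du t))) @[h --> 0^'] --> 0
    & forall t, I t ->
        normV (addC_fun (du s) (scaleC_fun (-1) (du t))) @[s --> t] --> 0].

End spaces.

Arguments cdistribution : clear implicits.

Section hamiltonian_nls.
Context {R : realType}.
Variable p : R.
Implicit Types (u v xi : R -> R[i]) (z w : (R -> R[i]) * R).

Local Notation mu := (@lebesgue_measure R).

Definition power_nl u : R -> R[i] :=
  fun x => (Normc.normc (u x) `^ (p - 1))%:C * u x.

Definition hamiltonian u : R :=
  \int[mu]_x (4^-1 * Normc.normc (Dx u x) ^+ 2
              - (p + 1)^-1 * Normc.normc (u x) `^ (p + 1)).

Definition dH u v : R :=
  derive1 (fun s : R => hamiltonian (addC_fun u (scaleC_fun s v))) 0.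

(* The distribution -1/2 u'' - |u|^(p-1) u. *)
Definition nls_rhs u : cdistribution R :=
  fun phi => - (2^-1)%:C * Ddistr (Ddistr (distr u)) phi
             - distr (power_nl u) phi.

Definition nls_solution (I : set R) (u du : R -> R -> R[i]) : Prop :=
  forall t, I t -> eq_distr (fun phi => iC * distr (du t) phi) (nls_rhs (u t)).

(* [xi] in H1 is the value at [u] of the Hamiltonian vector field. *)
Definition is_Xi_H u xi : Prop := H1 xi /\ forall v, H1 v -> omega v xi = dH u v.

Definition Xi_H_distr u : cdistribution R := fun phi => iC^-1 * nls_rhs u phi.

(* The points (u, t) of V x R, and likewise its tangent vectors (v, T). *)
Definition Vt : set ((R -> R[i]) * R) := [set z | H1 z.1].

Definition translate z (s : R) w : (R -> R[i]) * R :=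
  (addC_fun z.1 (scaleC_fun s w.1), z.2 + s * w.2).

Definition alpha z w : R := 2^-1 * omega z.1 w.1 - hamiltonian z.1 * w.2.

(* d(form)(w1, w2) = w1(form(w2)) - w2(form(w1)), with w1 and w2 extended to
   constant vector fields, so that the bracket term vanishes. *)
Definition ext_deriv (form : (R -> R[i]) * R -> (R -> R[i]) * R -> R)
    z w1 w2 : R :=
  derive1 (fun s : R => form (translate z s w1) w2) 0
  - derive1 (fun s : R => form (translate z s w2) w1) 0.

(* With [dH] as above, this evaluates on Vt to
   omega v1 v2 - dH u v1 * T2 + dH u v2 * T1. *)
Definition omegat := ext_deriv alpha.

Definition ker_omegat z : set ((R -> R[i]) * R) :=
  [set w | Vt w /\ forall w', Vt w' -> omegat z w w' = 0].

(* The real line spanned by [w], as a set of representatives. *)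
Definition real_line w : set ((R -> R[i]) * R) :=
  [set w' | Vt w' /\ exists2 a : R,
     w'.1 = scaleC_fun a w.1 %[ae mu] & w'.2 = a * w.2].

End hamiltonian_nls.

(* Main.v *)
Require Import Defs.
From mathcomp Require Import all_boot all_order all_algebra.
From mathcomp Require Import all_classical all_reals all_analysis.
From mathcomp Require Import complex ring lra measurable_realfun.

Set Implicit Arguments.
Unset Strict Implicit.
Unset Printing Implicit Defensive.

Import Order.TTheory GRing.Theory Num.Theory.
Import numFieldNormedType.Exports.

Local Open Scope classical_set_scope.
Local Open Scope ring_scope.
Local Open Scope complex_scope.

(** The constant vector fields on the extended phase space give
    [omegat (v1, T1) (v2, T2) = omega v1 v2 - dH v1 T2 + dH v2 T1], so a vector
    (v, T) in the kernel satisfies [omega v' v = T dH u v'] for all v' in H^1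
    (pair it with (v', 0), [ker_omegat_vertical]).  For T = 1 this says that v is the
    Hamiltonian vector field Xi_H; in general, where Xi_H is defined,
    nondegeneracy of [omega] ([omega_nondegenerate]) gives v = T Xi_H almost
    everywhere.  Conversely, pairing (T Xi_H, T) with (0, 1) gives
    [- T dH u Xi_H = - T omega Xi_H Xi_H = 0].

    Two analytic facts turn this into the statement about the equation.

    First, the Hamiltonian is differentiable along lines of H^1, with
    [dH u v = 1/2 <Dx u, Dx v> - <|u|^(p-1) u, v>] ([is_derive_hamiltonian]).
    Functions of H^1 are essentially bounded ([rweak_bounded]), so that the
    derivative of |u + s v|^(p+1) in s is dominated by a combination of products
    of square-integrable functions, and one differentiates under the integral.

    Second, the weak form [omega v xi = 1/2 <Dx u, Dx v> - <|u|^(p-1) u, v>] for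
    all v in H^1 is equivalent to the equation of distributions
    ([first_variation_distr]).  Test functions phi and i phi give one direction.
    For the other, the equation says that [Dx u] itself has a
    square-integrable weak derivative, and one integrates by parts against [Dx v]
    ([rweak_parts]).

    Everything about weak derivatives rests on Lebesgue points.  Let theta be a
    smooth step, equal to 0 before -1 and to 1 after 1.  Testing against
    theta((x - a)/r) - theta((x - b)/r) and letting r tend to 0 yields [f b - f a = \int_a^b g] at Lebesgue points a
    and b of f, when g is a weak derivative of f ([rweak_ftc]).  Fubini on a
    triangle then gives the product rule on [a, b] ([rweak_product]).  Integration
    by parts on the line follows because the integrable product f1 f2 takes
    small values at Lebesgue points arbitrarily far out in both directions.  The
    derivative of the step is a mollifier, which shows that a function
    annihilating all test functions is null ([test_ae_eq0]), hence that weak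
    derivatives are unique. *)

Local Notation mu := (@lebesgue_measure _).
(** Integrability on the whole line, and square-integrability. *)
Local Notation rint f := (mu.-integrable setT (EFin \o f)).
Local Notation L2r f := (f \in Lfun mu 2%:E).
Local Notation reC := (@complex.Re _).
Local Notation imC := (@complex.Im _).

(** * Smooth functions and a smooth step *)

Section smooth.
Context {R : realType}.
Implicit Types (f g : R -> R) (x a b : R).

(** Infinitely differentiable functions on the line. *)
Definition smooth f := forall n x, derivable (derive1n n f) x 1.

Lemma is_derive_derive1 f x d : is_derive x 1 f d -> derive1 f x = d.
Proof. by move=> [_ <-]; rewrite derive1E. Qed.

Lemma is_derive_mul f g x a b : is_derive x 1 f a -> is_derive x 1 g b ->
  is_derive x 1 (fun y => f y * g y) (f x * b + a * g x).
Proof.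
move=> fa gb; have := is_deriveM fa gb.
by rewrite /GRing.scale/= [g x * a]mulrC.
Qed.

Lemma is_derive_add f g x a b : is_derive x 1 f a -> is_derive x 1 g b ->
  is_derive x 1 (fun y => f y + g y) (a + b).
Proof. by move=> fa gb; have := is_deriveD fa gb. Qed.

Lemma is_derive_expr f n x a : is_derive x 1 f a ->
  is_derive x 1 (fun y => f y ^+ n) (n%:R * f x ^+ n.-1 * a).
Proof.
move=> fa; have -> : (fun y => f y ^+ n) = f ^+ n.
  by apply/funext => y; rewrite fctE.
exact: is_deriveX.
Qed.

Lemma is_derive_affine a b x : is_derive x 1 (fun y => a * y + b) a.
Proof.
have := is_derive_add (is_derive_mul (is_derive_cst a x 1) (is_derive_id x 1))
  (is_derive_cst b x 1).
by rewrite mulr1 mul0r !addr0.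
Qed.

Lemma is_derive_comp_affine f a b x d : is_derive (a * x + b) 1 f d ->
  is_derive x 1 (fun y => f (a * y + b)) (d * a).
Proof. by move=> fd; have := @is_derive1_comp _ f (fun y => a * y + b) x _ _ fd
  (is_derive_affine a b x). Qed.

Lemma is_derive_quadratic f (K : R) :
  (forall h, `|h| <= 1 -> `|f h| <= K * h ^+ 2) -> is_derive (0 : R) 1 f 0.
Proof.
move=> fK.
have f0 : f 0 = 0.
  by have := fK 0; rewrite normr0 expr0n/= mulr0 normr_le0 => /(_ ler01)/eqP.
have K0 : 0 <= K.
  by have := fK 1; rewrite normr1 lexx expr1n mulr1 => /(_ isT); exact: le_trans.
have H : (h^-1 *: (f (h *: 1 + 0) - f 0)) @[h --> (0:R)^'] --> (0 : R).
  apply/cvgrPdist_le => /= e e0.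
  near=> h.
  have h0 : h != 0 by near: h; exact: nbhs_dnbhs_neq.
  have he : `|h| < e / (K + 1).
    by near: h; apply: dnbhs0_lt; rewrite divr_gt0// ltr_wpDl.
  have h1 : `|h| <= 1 by near: h; exact: dnbhs0_le.
  rewrite f0 subr0 sub0r normrN addr0 /GRing.scale/= mulr1 normrM normfV.
  rewrite ler_pdivrMl ?normr_gt0//; apply: (le_trans (fK h h1)).
  rewrite -normr_id -real_normK ?num_real// expr2 mulrA mulrC normr_id.
  rewrite ler_wpM2l//.
  have : `|h| * (K + 1) <= e by rewrite -ler_pdivlMr ?ltr_wpDl// ltW.
  by apply: le_trans; rewrite mulrDr mulr1 mulrC lerDl.
apply: DeriveDef; first by apply/cvg_ex; exists 0.
by rewrite /derive; apply/cvg_lim.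
Unshelve. all: by end_near. Qed.

(** A class of functions stable under differentiation is made of smooth
    functions. *)
Lemma smooth_coind (S : set (R -> R)) :
  (forall f, S f -> exists2 g, S g & forall x, is_derive x 1 f (g x)) ->
  forall f, S f -> smooth f.
Proof.
move=> H f Sf n.
have : S (derive1n n f).
  elim: n => [//|n /H[g Sg dg]]; rewrite derive1nS.
  suff -> : (derive1 (derive1n n f)) = g by [].
  by apply/funext => x; exact: is_derive_derive1.
by move=> /H[g _ dg] x; case: (dg x).
Qed.

Lemma smooth_is_derive f x : smooth f -> is_derive x 1 f (derive1 f x).
Proof.
by move=> sf; rewrite derive1E; apply: derivableP; exact: (sf 0%N).
Qed.

Lemma smooth_derive1 f : smooth f -> smooth (derive1 f).
Proof. by move=> sf n x; rewrite -derive1Sn; exact: sf. Qed.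

Lemma smooth_continuous f : smooth f -> continuous f.
Proof.
move=> sf x; apply: differentiable_continuous; apply/derivable1_diffP.
exact: (sf 0%N).
Qed.

Lemma smooth_cst (c : R) : smooth (cst c).
Proof.
apply: (@smooth_coind [set f | exists c, f = cst c]); last by exists c.
move=> _ [d ->]; exists (cst 0); first by exists 0.
by move=> x; exact: is_derive_cst.
Qed.

Lemma smooth_add f g : smooth f -> smooth g -> smooth (fun x => f x + g x).
Proof.
move=> sf sg; apply: (@smooth_coind [set h | exists f g,
  [/\ smooth f, smooth g & h = (fun x => f x + g x)]]); last by exists f, g.
move=> _ [f1 [g1 [sf1 sg1 ->]]]; exists (fun x => derive1 f1 x + derive1 g1 x).
  by exists (derive1 f1), (derive1 g1); split; [exact: smooth_derive1|exact: smooth_derive1|by []].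
by move=> x; apply: is_derive_add; exact: smooth_is_derive.
Qed.

(** Finite sums of products of smooth functions; the class stable under
    differentiation that contains a given product. *)
Inductive sum_of_products : (R -> R) -> Prop :=
| SumOfProductsMul f g : smooth f -> smooth g ->
    sum_of_products (fun x => f x * g x)
| SumOfProductsAdd f g : sum_of_products f -> sum_of_products g ->
    sum_of_products (fun x => f x + g x).

Lemma smooth_mul f g : smooth f -> smooth g -> smooth (fun x => f x * g x).
Proof.
move=> sf sg; apply: (@smooth_coind sum_of_products); last exact: SumOfProductsMul.
move=> h; elim => {f g sf sg h} [f g sf sg|f g _ [f' Sf' df] _ [g' Sg' dg]].
- exists (fun x => f x * derive1 g x + derive1 f x * g x).
    apply: SumOfProductsAdd; apply: SumOfProductsMul;
      [exact: sf|exact: smooth_derive1|exact: smooth_derive1|exact: sg].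
  by move=> x; apply: is_derive_mul; exact: smooth_is_derive.
- exists (fun x => f' x + g' x); first exact: SumOfProductsAdd.
  by move=> x; exact: is_derive_add.
Qed.

Lemma smooth_comp_affine f a b : smooth f -> smooth (fun x => f (a * x + b)).
Proof.
move=> sf; apply: (@smooth_coind [set h | exists2 f, smooth f &
   exists c, h = fun x => f (a * x + b) * c]); last first.
  by exists f => //; exists 1; apply/funext => x; rewrite mulr1.
move=> _ [{sf}f sf [c ->]]; exists (fun x => (derive1 f) (a * x + b) * (a * c)).
  by exists (derive1 f); [exact: smooth_derive1|exists (a * c)].
move=> x.
have := is_derive_mul (is_derive_comp_affine (smooth_is_derive (a * x + b) sf))
  (is_derive_cst c x 1).
by rewrite mulr0 add0r mulrA.
Qed.

Lemma smooth_inv f : smooth f -> (forall x, f x != 0) ->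
  smooth (fun x => (f x)^-1).
Proof.
move=> sf f0; apply: (@smooth_coind [set h | exists2 g, smooth g &
   exists n, h = fun x => g x * (f x)^-1 ^+ n]); last first.
  by exists (cst 1); [exact: smooth_cst|exists 1%N; apply/funext => x; rewrite mul1r].
move=> _ [g sg [n ->]].
(* the derivative of g / f^n is (g' f - n g f') / f^(n+1) *)
exists (fun x => (derive1 g x * f x + (- n%:R) * (g x * derive1 f x)) * (f x)^-1 ^+ n.+1).
  exists (fun x => derive1 g x * f x + (- n%:R) * (g x * derive1 f x)); last by exists n.+1.
  apply: smooth_add; first exact: (smooth_mul (smooth_derive1 sg)).
  apply: smooth_mul; first exact: smooth_cst.
  by apply: smooth_mul; [exact: sg|exact: smooth_derive1].
move=> x; have dV := is_deriveV (f0 x) (smooth_is_derive x sf).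
have := is_derive_mul (smooth_is_derive x sg) (is_derive_expr n dV).
congr (is_derive _ _ _ _); rewrite /GRing.scale/=.
have fx := f0 x; case: n => [|n]; first by rewrite !expr0 expr1; field.
by rewrite -pred_Sn !exprVn !exprS; field; rewrite expf_neq0.
Qed.

(** The functions P(1/x) exp(-1/x), extended by 0 to the left half-line. *)
Definition flatexp (P : {poly R}) : R -> R := fun x =>
  if 0 < x then P.[x^-1] * expR (- x^-1) else 0.

Lemma horner_bound (P : {poly R}) :
  exists n, exists2 C, 0 <= C & forall y, 1 <= y -> `|P.[y]| <= C * y ^+ n.
Proof.
elim/poly_ind: P => [|P c [n [C C0 HC]]].
  by exists 0%N, 0 => // y _; rewrite horner0 normr0 mul0r.
exists n.+1, (C + `|c|); first exact: addr_ge0.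
move=> y y1; rewrite hornerMXaddC (le_trans (ler_normD _ _))// mulrDl lerD//.
  have y0 : 0 <= y by exact: le_trans y1.
  by rewrite normrM (ger0_norm y0) exprSr mulrA ler_wpM2r// HC.
by rewrite ler_peMr// exprn_ege1.
Qed.

Lemma flatexp_bound P : exists K, forall h, `|flatexp P h| <= K * h ^+ 2.
Proof.
have [n [C C0 HC]] := horner_bound P.
(* below x = 1 the bound comes from exp y >= y^(n+2)/(n+2)! at y = 1/x;
   above, |P(1/x)| is at most the sum of the absolute values of its
   coefficients *)
pose S := \sum_(i < size P) `|P`_i|.
exists (C * (n.+2)`!%:R + S) => h; rewrite /flatexp.
have S0 : 0 <= S by exact: sumr_ge0.
case: ifPn => h0; last first.
  by rewrite normr0; apply: mulr_ge0; [apply: addr_ge0 => //; apply: mulr_ge0|exact: sqr_ge0].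
rewrite normrM (ger0_norm (expR_ge0 _)).
have [h1|h1] := leP h 1.
  have y1 : 1 <= h^-1 by rewrite invf_ge1.
  rewrite mulrDl -[leLHS]addr0 lerD//; last by rewrite mulr_ge0 ?sqr_ge0.
  have y0 : 0 < h^-1 by rewrite invr_gt0.
  have : h^-1 ^+ n.+2 / n.+2`!%:R <= expR h^-1.
    by apply: le_trans (expR_ge1Dxn n.+1 (ltW y0)); rewrite lerDr.
  rewrite ler_pdivrMr ?ltr0n ?fact_gt0// => Hy.
  rewrite expRN -ler_pdivlMr ?invr_gt0 ?expR_gt0// invrK.
  apply: (le_trans (HC _ y1)); rewrite -!mulrA ler_wpM2l//.
  rewrite -(ler_pM2r (_ : 0 < h^-1 ^+ 2)) ?exprn_gt0// -exprD addn2.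
  apply: (le_trans Hy); rewrite mulrC le_eqVlt; apply/orP; left; apply/eqP.
  by rewrite exprVn; field; rewrite gt_eqF.
rewrite mulrDl -[leLHS]add0r lerD//; first by apply: mulr_ge0; [exact: mulr_ge0|exact: sqr_ge0].
have y0 : 0 <= h^-1 by rewrite invr_ge0 ltW.
have y1 : h^-1 <= 1 by rewrite invf_le1// ltW.
rewrite -[leRHS]mulr1 -mulrA ler_pM//.
- rewrite horner_coef (le_trans (ler_norm_sum _ _ _))// ler_sum// => i _.
  by rewrite normrM ler_piMr// normrX (ger0_norm y0) exprn_ile1.
- rewrite mulr1 (@le_trans _ _ 1)//; first by rewrite -expR0 ler_expR oppr_le0.
  by rewrite exprn_ege1// ltW.
Qed.

Lemma smooth_flatexp P : smooth (flatexp P).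
Proof.
apply: (@smooth_coind (range flatexp)); last by exists P.
move=> _ [{}P _ <-]; exists (flatexp ('X^2 * (P - P^`()))); first by eexists.
move=> x; have [x0|x0|->] := ltgtP x 0.
- rewrite {2}/flatexp ltNge (ltW x0)/=.
  apply: (@near_eq_is_derive _ _ _ (cst 0)).
  near=> y; rewrite /flatexp ltNge ifF//; apply/negbTE; rewrite negbK.
  by apply/ltW; near: y; exact: lt_nbhsl.
- rewrite {2}/flatexp x0.
  apply: (@near_eq_is_derive _ _ _ (fun x => P.[x^-1] * expR (- x^-1))).
    near=> y; rewrite /flatexp ifT//; near: y; exact: lt_nbhsr.
  have xn0 : x != 0 by rewrite gt_eqF.
  have dV : is_derive x 1 (fun y : R => y^-1) (- x ^- 2).
    by have := is_deriveV xn0 (is_derive_id x 1); rewrite /GRing.scale/= mulr1.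
  have dP : is_derive x 1 (fun y : R => P.[y^-1]) (P^`().[x^-1] * - x ^- 2).
    by have := @is_derive1_comp _ (horner P) (fun y => y^-1) x _ _ (is_derive_poly P x^-1) dV.
  have dE : is_derive x 1 (fun y : R => expR (- y^-1)) (expR (- x^-1) * x ^- 2).
    have dN : is_derive x 1 (fun y : R => - y^-1) (x ^- 2).
      by have := is_deriveN dV; rewrite opprK.
    by have := @is_derive1_comp _ expR (fun y => - y^-1) x _ _ (is_derive_expR (- x^-1)) dN.
  have := is_derive_mul dP dE; congr (is_derive _ _ _ _).
  by rewrite hornerM hornerXn hornerD hornerN exprVn; ring.
- rewrite {2}/flatexp ltxx; have [K HK] := flatexp_bound P.
  by apply: (@is_derive_quadratic _ K) => h _; exact: HK.
Unshelve. all: by end_near. Qed.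

(** A smooth step, equal to 0 up to -1 and to 1 from 1 on. *)
Definition step x : R :=
  flatexp 1 (1 + x) / (flatexp 1 (1 + x) + flatexp 1 (1 - x)).

Lemma flatexp1_ge0 x : 0 <= flatexp 1 x.
Proof.
by rewrite /flatexp; case: ifPn => // _; rewrite hornerE mul1r expR_ge0.
Qed.

Lemma flatexp1_gt0 x : 0 < x -> 0 < flatexp 1 x.
Proof. by rewrite /flatexp => ->; rewrite hornerE mul1r expR_gt0. Qed.

Lemma flatexp_le0 P x : x <= 0 -> flatexp P x = 0.
Proof. by rewrite /flatexp leNgt => /negbTE ->. Qed.

Lemma step_denom_gt0 x : 0 < flatexp 1 (1 + x) + flatexp 1 (1 - x).
Proof.
have [x0|x0] := leP 0 x.
  by rewrite ltr_pwDl ?flatexp1_ge0// flatexp1_gt0// ltr_pwDl.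
by rewrite ltr_wpDl ?flatexp1_ge0// flatexp1_gt0// subr_gt0 (lt_trans x0).
Qed.

Lemma smooth_step : smooth step.
Proof.
have E1 : smooth (fun x => flatexp 1 (1 + x)).
  rewrite (_ : (fun _ => _) = fun x => flatexp 1 (1 * x + 1)); last first.
    by apply/funext => x; rewrite mul1r addrC.
  exact/smooth_comp_affine/smooth_flatexp.
have E2 : smooth (fun x => flatexp 1 (1 - x)).
  rewrite (_ : (fun _ => _) = fun x => flatexp 1 (-1 * x + 1)); last first.
    by apply/funext => x; rewrite mulN1r addrC.
  exact/smooth_comp_affine/smooth_flatexp.
apply: smooth_mul; first exact: E1.
apply: smooth_inv; first exact: smooth_add.
by move=> x; rewrite gt_eqF// step_denom_gt0.
Qed.

Lemma step_le x : x <= -1 -> step x = 0.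
Proof.
by move=> x1; rewrite /step flatexp_le0 ?mul0r// -lerBrDl sub0r.
Qed.

Lemma step_ge x : 1 <= x -> step x = 1.
Proof.
move=> x1; rewrite /step (@flatexp_le0 _ (1 - x)) ?subr_le0// addr0 divff//.
by rewrite gt_eqF// flatexp1_gt0// ltr_pwDl// (le_trans _ x1).
Qed.

Lemma step_ge0 x : 0 <= step x.
Proof. by rewrite divr_ge0// ?flatexp1_ge0// ltW// step_denom_gt0. Qed.

Lemma step_le1 x : step x <= 1.
Proof.
by rewrite ler_pdivrMr ?step_denom_gt0// mul1r lerDl flatexp1_ge0.
Qed.

End smooth.

(** * Integrals of real functions, square-integrable functions *)

Section integrals.
Context {R : realType}.
Implicit Types (f g : R -> R) (a b x : R) (D : set R).

Lemma ae_imp (P Q : R -> Prop) : {ae mu, forall x, P x} ->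
  (forall x, P x -> Q x) -> {ae mu, forall x, Q x}.
Proof.
have F := ae_filter_ringOfSetsType mu.
by move=> + PQ; apply: filterS => x; exact: PQ. Qed.

Lemma ae_imp2 (P Q S : R -> Prop) : {ae mu, forall x, P x} ->
  {ae mu, forall x, Q x} -> (forall x, P x -> Q x -> S x) ->
  {ae mu, forall x, S x}.
Proof.
have F := ae_filter_ringOfSetsType mu.
by move=> + + PQ; apply: filterS2 => x; exact: PQ. Qed.

Lemma rintD f g : rint f -> rint g -> rint (fun x => f x + g x).
Proof.
move=> fi gi; rewrite (_ : _ \o _ = (EFin \o f) \+ (EFin \o g))//.
exact: integrableD.
Qed.

Lemma rintZ a f : rint f -> rint (fun x => a * f x).
Proof.
move=> fi; rewrite (_ : _ \o _ = (fun x => a%:E * (EFin \o f) x)%E)//.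
exact: integrableZl.
Qed.

Lemma rintN f : rint f -> rint (fun x => - f x).
Proof.
by move=> /(rintZ (-1)); congr (_.-integrable _ (_ \o _)); apply/funext => x; rewrite mulN1r.
Qed.

Lemma rintB f g : rint f -> rint g -> rint (fun x => f x - g x).
Proof. by move=> fi gi; apply: rintD => //; exact: rintN. Qed.

Lemma rint_meas f : rint f -> measurable_fun setT f.
Proof. by move=> /integrableP[/measurable_EFinP]. Qed.

Lemma rint_norm f : rint f -> rint (fun x => `|f x|).
Proof. exact: integrable_norm. Qed.

Lemma rintS f D : measurable D -> rint f -> mu.-integrable D (EFin \o f).
Proof. by move=> mD; apply: integrableS. Qed.

Lemma rint_le f g : measurable_fun setT f ->
  (forall x, `|f x| <= g x) -> rint g -> rint f.
Proof.
move=> mf fg; apply: le_integrable => //; first exact/measurable_EFinP.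
by move=> x _; rewrite /= lee_fin (le_trans (fg x))// ler_norm.
Qed.

Lemma integrable_ae_bound f g : measurable_fun setT f ->
  {ae mu, forall x, `|f x| <= g x} -> rint g -> rint f.
Proof.
move=> mf fg /integrableP[mg ig]; apply/integrableP.
have mEf : measurable_fun setT (EFin \o f) by exact/measurable_EFinP.
split => //.
apply: le_lt_trans ig; apply: ae_ge0_le_integral => //.
- exact: measurableT_comp.
- exact: measurableT_comp.
- apply: (ae_imp fg) => x fgx _.
  by rewrite /= lee_fin (le_trans fgx)// ler_norm.
Qed.

Lemma eq_Rintegral_ae D f g : measurable D ->
  measurable_fun setT f -> measurable_fun setT g ->
  f = g %[ae mu] -> \int[mu]_(x in D) f x = \int[mu]_(x in D) g x.
Proof.
move=> mD mf mg fg; congr fine; apply: ae_eq_integral => //.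
- by apply/measurable_EFinP; apply: measurable_funS mf.
- by apply/measurable_EFinP; apply: measurable_funS mg.
- by apply: (ae_imp fg) => x fgx Dx /=; rewrite fgx.
Qed.

Lemma Rdominated_cvg (f_ : nat -> R -> R) f g :
  (forall n, measurable_fun setT (f_ n)) -> measurable_fun setT f ->
  {ae mu, forall x, f_ ^~ x @ \oo --> f x} ->
  rint g -> (forall n x, `|f_ n x| <= g x) ->
  (\int[mu]_x f_ n x) @[n --> \oo] --> \int[mu]_x f x.
Proof.
move=> mf_ mf f_f gi f_g.
have [] := @dominated_convergence _ _ R mu setT measurableT
  (fun n => EFin \o f_ n) (EFin \o f) (EFin \o g).
- by move=> n; apply/measurable_EFinP; exact: mf_.
- exact/measurable_EFinP.
- by apply: (ae_imp f_f) => x f_fx _; apply: cvg_EFin => //; exact: nearW.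
- exact: gi.
- by apply: aeW => x n _; rewrite /= lee_fin.
move=> fi _ H; apply: (@fine_cvg _ _ _ _ _ (\int[mu]_x f x)).
by rewrite /Rintegral fineK// integrable_fin_num.
Qed.

Lemma L2r_meas f : L2r f -> measurable_fun setT f.
Proof. by move=> /sub_Lfun_mfun; rewrite inE. Qed.

Lemma L2rP f : measurable_fun setT f -> rint (fun x => f x ^+ 2) -> L2r f.
Proof.
move=> mf /integrableP[_ fi]; apply/andP; split; first by rewrite inE.
rewrite inE /= /finite_norm unlock /Lnorm/=.
apply: poweR_lty; apply: le_lt_trans fi; rewrite le_eqVlt; apply/orP; left.
apply/eqP; apply: eq_integral => x _.
by rewrite /= powR_mulrn// normrX.
Qed.

Lemma L2r_sqr f : L2r f -> rint (fun x => f x ^+ 2).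
Proof. exact: Lfun2_integrable_sqr. Qed.

Lemma L2r_mul f g : L2r f -> L2r g -> rint (fun x => f x * g x).
Proof. by move=> lf lg; apply/Lfun1_integrable; exact: Lfun2_mul_Lfun1. Qed.

Lemma L2r_add f g : L2r f -> L2r g -> L2r (fun x => f x + g x).
Proof.
move=> lf lg; have mf := L2r_meas lf; have mg := L2r_meas lg.
apply: L2rP; first exact: measurable_funD.
rewrite (_ : _ \o _ = EFin \o (fun x => (f x ^+ 2 + 2 * (f x * g x)) + g x ^+ 2)).
  by apply: rintD; [apply: rintD; [exact: L2r_sqr|exact/rintZ/L2r_mul]|exact: L2r_sqr].
by apply/funext => x /=; congr EFin; ring.
Qed.

Lemma L2r_bounded_mul (M : R) f g : measurable_fun setT g ->
  (forall x, `|g x| <= M) -> L2r f -> L2r (fun x => g x * f x).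
Proof.
move=> mg gM lf; have mf := L2r_meas lf.
apply: L2rP; first exact: measurable_funM.
apply: (@rint_le _ (fun x => M ^+ 2 * f x ^+ 2)); last exact/rintZ/L2r_sqr.
  by apply: measurable_funX; exact: measurable_funM.
move=> x; rewrite ger0_norm ?sqr_ge0// exprMn ler_wpM2r ?sqr_ge0//.
by rewrite -real_normK ?num_real// lerXn2r// nnegrE// (le_trans _ (gM x)).
Qed.

Lemma L2r_scale a f : L2r f -> L2r (fun x => a * f x).
Proof. by apply: (@L2r_bounded_mul `|a| f (cst a)). Qed.

Lemma L2r_opp f : L2r f -> L2r (fun x => - f x).
Proof.
move=> lf; rewrite (_ : (fun x => - f x) = fun x => -1 * f x).
  exact: L2r_scale.
by apply/funext => x; rewrite mulN1r.
Qed.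

Lemma L2r_ae f g : measurable_fun setT g -> f = g %[ae mu] -> L2r f -> L2r g.
Proof.
move=> mg fg lf; apply: L2rP => //.
apply: (@integrable_ae_bound _ (fun x => f x ^+ 2)); last exact: L2r_sqr.
  exact: measurable_funX.
by apply: (ae_imp fg) => x /(_ I) ->; rewrite ger0_norm ?sqr_ge0.
Qed.

Lemma L2r_integrable_itv f a b : L2r f -> mu.-integrable `[a, b] (EFin \o f).
Proof.
move=> lf; have mf := L2r_meas lf.
have ig : mu.-integrable `[a, b] (EFin \o (fun x => 1 + f x ^+ 2)).
  rewrite (_ : _ \o _ = (EFin \o cst 1) \+ (EFin \o fun x => f x ^+ 2))//.
  apply: integrableD => //; last exact/rintS/L2r_sqr.
  apply: continuous_compact_integrable; first exact: segment_compact.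
  by apply: continuous_subspaceT => x; exact: cvg_cst.
apply: le_integrable ig => //.
  by apply/measurable_EFinP; apply: measurable_funS mf.
move=> x _; rewrite /= lee_fin (@ger0_norm _ (1 + _)) ?addr_ge0 ?sqr_ge0//.
rewrite -(real_normK (num_real (f x))); set y := `|f x|.
by have := sqr_ge0 (y - 2^-1); nra.
Qed.

Lemma L2r_patch_integrable f a b : L2r f -> rint (f \_ `[a, b]).
Proof.
move=> lf; rewrite -restrict_EFin; apply: (integrable_mkcond _ _).1 => //.
exact: L2r_integrable_itv.
Qed.

Lemma locally_integrable_L2r f : L2r f -> locally_integrable setT f.
Proof.
move=> lf; split; [exact: L2r_meas|exact: openT|].
move=> K _ cK; have [M [Mr KM]] := compact_bounded cK.
have KI : K `<=` `[- (M + 1), M + 1].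
  by move=> x Kx /=; rewrite in_itv/= -ler_norml; apply: KM => //; rewrite ltrDl.
have /integrableP[_] := L2r_integrable_itv (- (M + 1)) (M + 1) lf.
apply: le_lt_trans; apply: ge0_subset_integral => //.
  exact: compact_measurable.
do 2 apply: measurableT_comp => //.
by apply: measurable_funS (L2r_meas lf).
Qed.

Lemma integrable_continuous_support (A : R) f : continuous f ->
  (forall x, A < `|x| -> f x = 0) -> rint f.
Proof.
move=> cf fA.
have -> : f = f \_ `[- A, A].
  apply/funext => x; rewrite patchE; case: ifPn => //.
  rewrite notin_setE/= in_itv/= -ler_norml => /negP; rewrite -ltNge.
  exact: fA.
rewrite -restrict_EFin; apply: (integrable_mkcond _ _).1 => //.
apply: continuous_compact_integrable; first exact: segment_compact.
exact: continuous_subspaceT.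
Qed.

Lemma Rintegral_support (A : R) f : (forall x, A < `|x| -> f x = 0) ->
  \int[mu]_x f x = \int[mu]_(x in `[- A, A]) f x.
Proof.
move=> fA; rewrite [RHS]Rintegral_mkcond; congr (Rintegral _ _ _).
apply/funext => x; rewrite patchE; case: ifPn => //.
rewrite notin_setE/= in_itv/= -ler_norml => /negP; rewrite -ltNge.
exact: fA.
Qed.

Lemma Rintegral_derive1 f a b : a < b -> (forall x, derivable f x 1) ->
  continuous (derive1 f) -> \int[mu]_(x in `[a, b]) derive1 f x = f b - f a.
Proof.
move=> ab df cdf; rewrite /Rintegral (@continuous_FTC2 _ (derive1 f) f a b ab).
- by [].
- exact: continuous_subspaceT.
- have cf : continuous f.
    by move=> x; apply: differentiable_continuous; apply/derivable1_diffP.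
  split => //; first by apply: cvg_at_right_filter; exact: cf.
  by apply: cvg_at_left_filter; exact: cf.
- by [].
Qed.

End integrals.

(** * Test functions and weak derivatives of real functions *)

Section weak.
Context {R : realType}.
Implicit Types (f g phi : R -> R) (a b x r : R) (D : set R).

Lemma test_smooth phi : test_function phi -> smooth phi.
Proof. by case. Qed.

Lemma test_support phi : test_function phi ->
  exists2 A, 0 < A & forall x, A < `|x| -> phi x = 0.
Proof.
move=> [_ /compact_bounded[M [Mr KM]]]; exists (`|M| + 1).
  by rewrite ltr_wpDl.
move=> x Mx; apply/eqP; apply: contraPP Mx => x0; apply/negP; rewrite -leNgt.
apply: KM; first by rewrite (le_lt_trans (ler_norm _))// ltrDl.
by apply: subset_closure; exact/negP.
Qed.

Lemma test_functionI (A : R) phi : smooth phi ->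
  (forall x, A < `|x| -> phi x = 0) -> test_function phi.
Proof.
move=> sphi phiA; split => //.
apply: (@subclosed_compact _ _ `[- A, A]).
- exact: closed_closure.
- exact: segment_compact.
- have /closure_id -> : closed `[- A, A] by exact: interval_closed.
  apply: closureS => x /= x0; rewrite in_itv/= -ler_norml leNgt.
  by apply: contra x0 => /phiA/eqP.
Qed.

Lemma derive1_support (A : R) phi : (forall x, A < `|x| -> phi x = 0) ->
  forall x, A < `|x| -> derive1 phi x = 0.
Proof.
move=> phiA x Ax; rewrite derive1E -(derive_cst (0 : R) x 1).
apply: near_eq_derive; near=> y; rewrite phiA//.
near: y; apply: (@cvgr_gt _ _ _ _ (fun y : R => `|y|) `|x|) => //.
exact: norm_continuous.
Unshelve. all: by end_near. Qed.

Lemma test_derive1 phi : test_function phi -> test_function (derive1 phi).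
Proof.
move=> tphi; have [A _ phiA] := test_support tphi.
apply: (@test_functionI A); first exact/smooth_derive1/test_smooth.
exact: derive1_support.
Qed.

Lemma test_continuous phi : test_function phi -> continuous phi.
Proof. by move=> /test_smooth; exact: smooth_continuous. Qed.

Lemma test_meas phi : test_function phi -> measurable_fun setT phi.
Proof. by move=> /test_continuous; exact: continuous_measurable_fun. Qed.

Lemma test_integrable phi : test_function phi -> rint phi.
Proof.
move=> tphi; have [A _ phiA] := test_support tphi.
exact: integrable_continuous_support (test_continuous tphi) phiA.
Qed.

Lemma test_mul phi psi : test_function phi -> test_function psi ->
  test_function (fun x => phi x * psi x).
Proof.
move=> tphi tpsi; have [A _ phiA] := test_support tphi.
apply: (@test_functionI A); last by move=> x /phiA ->; rewrite mul0r.
by apply: smooth_mul; exact: test_smooth.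
Qed.

Lemma test_L2r phi : test_function phi -> L2r phi.
Proof.
move=> tphi; apply: L2rP; first exact: test_meas.
exact/test_integrable/test_mul.
Qed.

Lemma continuous_bounded_itv f a b : continuous f ->
  exists2 M, 0 <= M & forall x, a <= x <= b -> `|f x| <= M.
Proof.
move=> cf.
have /compact_bounded[M [Mr KM]] : compact (f @` `[a, b]).
  apply: continuous_compact; last exact: segment_compact.
  exact: continuous_subspaceT.
exists (`|M| + 1); first by rewrite addr_ge0.
move=> x axb; apply: KM; first by rewrite (le_lt_trans (ler_norm _))// ltrDl.
by exists x => //=; rewrite in_itv.
Qed.

Lemma Rintegral_derive1_support (A : R) f c : 0 < A -> smooth f ->
  (forall x, A < `|x| -> derive1 f x = 0) ->
  f (- A) = 0 -> f A = c ->
  \int[mu]_x derive1 f x = c.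
Proof.
move=> A0 sf fA f0 f1; rewrite (Rintegral_support fA) Rintegral_derive1//.
- by rewrite f0 f1 subr0.
- by rewrite (lt_trans _ A0)// oppr_lt0.
- exact: (sf 0%N).
- exact/smooth_continuous/smooth_derive1.
Qed.

Lemma Rintegral_test_derive1 phi : test_function phi ->
  \int[mu]_x derive1 phi x = 0.
Proof.
move=> tphi; have [A A0 phiA] := test_support tphi.
have AA : A < A + 1 by rewrite ltrDl.
have A10 : 0 < A + 1 by exact: lt_trans AA.
apply: (@Rintegral_derive1_support (A + 1)) => //.
- exact: test_smooth.
- by move=> x Ax; apply: (derive1_support phiA); exact: lt_trans Ax.
- by apply: phiA; rewrite normrN gtr0_norm.
- by apply: phiA; rewrite gtr0_norm.
Qed.

(** The real function g is a weak derivative of the real function f. *)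
Definition rweak f g := forall phi, test_function phi ->
  \int[mu]_x (f x * derive1 phi x) = - \int[mu]_x (g x * phi x).

Lemma rweak_test phi : test_function phi -> rweak phi (derive1 phi).
Proof.
move=> tphi psi tpsi; apply/eqP; rewrite -subr_eq0 opprK.
rewrite -RintegralD//; last 2 first.
- exact/test_integrable/test_mul/test_derive1.
- by apply/test_integrable/test_mul => //; exact: test_derive1.
rewrite -[X in _ == X](Rintegral_test_derive1 (test_mul tphi tpsi)).
apply/eqP; congr (Rintegral _ _ _); apply/funext => x; apply/esym.
apply: is_derive_derive1; apply: is_derive_mul;
  exact/smooth_is_derive/test_smooth.
Qed.

(** ** Approximation at Lebesgue points *)

(** The step that rises from 0 to 1 between a - r and a + r. *)
Definition rstep r a x := step (r^-1 * x + - (r^-1 * a)).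

(** A function of integral 1 supported between a - r and a + r, for r > 0. *)
Definition mollifier r a := derive1 (rstep r a).

Lemma smooth_rstep r a : smooth (rstep r a).
Proof. exact/smooth_comp_affine/smooth_step. Qed.

Lemma rstep_ge0 r a x : 0 <= rstep r a x.
Proof. exact: step_ge0. Qed.

Lemma rstep_le1 r a x : rstep r a x <= 1.
Proof. exact: step_le1. Qed.

Lemma rstep_le r a x : 0 < r -> x <= a - r -> rstep r a x = 0.
Proof.
move=> r0 xar; apply: step_le; rewrite -mulrBr mulrC ler_pdivrMr// mulN1r.
by rewrite lerBlDr addrC.
Qed.

Lemma rstep_ge r a x : 0 < r -> a + r <= x -> rstep r a x = 1.
Proof.
move=> r0 xar; apply: step_ge; rewrite -mulrBr mulrC ler_pdivlMr// mul1r.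
by rewrite lerBrDr addrC.
Qed.

Lemma mollifierE r a x :
  mollifier r a x = derive1 step (r^-1 * x + - (r^-1 * a)) * r^-1.
Proof.
apply: is_derive_derive1; apply: is_derive_comp_affine.
exact/smooth_is_derive/smooth_step.
Qed.

Lemma derive1_step_out x : 1 < `|x| -> derive1 step x = 0.
Proof.
move=> x1; have [x0|x0] := leP 0 x.
- rewrite ger0_norm// in x1; rewrite derive1E -(derive_cst (1 : R) x 1).
  apply: near_eq_derive; near=> y; rewrite step_ge//.
  by near: y; exact: lt_le_nbhsr.
- rewrite ltr0_norm// in x1; rewrite derive1E -(derive_cst (0 : R) x 1).
  apply: near_eq_derive; near=> y; rewrite step_le//.
  by apply/ltW; near: y; apply: lt_nbhsl; rewrite ltrNr.
Unshelve. all: by end_near. Qed.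

Lemma mollifier_out r a x : 0 < r -> r < `|x - a| -> mollifier r a x = 0.
Proof.
move=> r0 rxa; rewrite mollifierE derive1_step_out ?mul0r//.
by rewrite -mulrBr normrM gtr0_norm ?invr_gt0// mulrC ltr_pdivlMr// mul1r.
Qed.

Lemma smooth_mollifier r a : smooth (mollifier r a).
Proof. exact/smooth_derive1/smooth_rstep. Qed.

Lemma test_mollifier r a : 0 < r -> test_function (mollifier r a).
Proof.
move=> r0; apply: (@test_functionI (`|a| + r)); first exact: smooth_mollifier.
move=> x xar; apply: mollifier_out => //.
have := ler_distD a x 0; rewrite !subr0 => H.
by rewrite -(ltrD2l `|a|) (lt_le_trans xar)// addrC.
Qed.

Lemma Rintegral_mollifier r a : 0 < r -> \int[mu]_x mollifier r a x = 1.
Proof.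
move=> r0; have A0 : 0 < `|a| + r by rewrite ltr_wpDl.
apply: (@Rintegral_derive1_support (`|a| + r)) => //.
- exact: smooth_rstep.
- move=> x xar; apply: mollifier_out => //.
  have := ler_distD a x 0; rewrite !subr0 => H.
  by rewrite -(ltrD2l `|a|) (lt_le_trans xar)// addrC.
- by apply: rstep_le => //; rewrite opprD lerD2r lerNl -normrN ler_norm.
- by apply: rstep_ge => //; rewrite lerD2r ler_norm.
Qed.

Lemma mollifier_bound : exists2 M : R, 0 <= M &
  forall r a x, 0 < r -> `|mollifier r a x| <= M / r.
Proof.
have cS : continuous (derive1 (@step R)).
  exact/smooth_continuous/smooth_derive1/smooth_step.
have [M M0 HM] := continuous_bounded_itv (-1) 1 cS.
exists M => // r a x r0; rewrite mollifierE normrM (gtr0_norm (_ : 0 < r^-1)) ?invr_gt0//.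
rewrite ler_wpM2r ?invr_ge0 ?(ltW r0)//.
set y := (X in derive1 _ X).
have [/derive1_step_out ->|] := ltP 1 `|y|; first by rewrite normr0.
by rewrite ler_norml; exact: HM.
Qed.

(** At a Lebesgue point, the averages against the mollifiers converge to the
    value of the function. *)
Lemma cvg_mollifier f a : L2r f -> lebesgue_pt f a ->
  (\int[mu]_x (f x * mollifier n.+1%:R^-1 a x)) @[n --> \oo] --> f a.
Proof.
move=> lf La; have mf := L2r_meas lf; have [M M0 HM] := mollifier_bound.
apply/cvgrPdist_le => /= e e0.
have M1 : 0 < 4 * M + 1 by rewrite ltr_wpDl// mulr_ge0.
have /fine_cvgP[fin_davg /cvgrPdist_le/(_ (e / (4 * M + 1)))] := La.
rewrite divr_gt0// => /(_ isT) near_davg.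
have [d /= d0 Hd] := filterI fin_davg near_davg.
have d20 : 0 < d / 2 by rewrite divr_gt0.
near=> n; have rd : n.+1%:R^-1 < d / 2.
  by near: n; exact: near_infty_natSinv_lt (PosNum d20).
set r : R := n.+1%:R^-1 in rd *.
have r0 : 0 < r by rewrite invr_gt0.
have r20 : 0 < 2 * r by rewrite mulr_gt0.
have tm := test_mollifier a r0.
have mm := test_meas tm.
rewrite -[X in `|X - _|]mulr1 -(Rintegral_mollifier a r0).
rewrite -RintegralZl//; last exact: test_integrable.
have ik : rint (fun x => f a * mollifier r a x - f x * mollifier r a x).
  by apply: rintB; [exact/rintZ/test_integrable|exact/L2r_mul/test_L2r].
rewrite -RintegralB//; last 2 first.
- exact/rintZ/test_integrable.
- exact/L2r_mul/test_L2r.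
have r2d : ball_ (fun x => `|x|) 0 d (2 * r).
  by rewrite /ball_/= sub0r normrN gtr0_norm// mulrC -ltr_pdivlMr.
have [fin_dav] := Hd _ r2d r20; rewrite /=.
rewrite sub0r normrN ger0_norm ?fine_ge0 ?davg_ge0// => dav_le.
have mh : measurable_fun setT (fun x => f x - f a) by exact: measurable_funB.
(* the mollifier is bounded by M / r and lives in the ball of radius 2r, of
   measure 4r, which leaves 4M times the average of |f - f a| *)
rewrite -lee_fin; apply: (@le_trans _ _ ((4 * M)%:E * davg f a (2 * r))%E); last first.
  rewrite -(fineK fin_dav) -EFinM lee_fin.
  rewrite (le_trans (ler_wpM2l _ dav_le)) ?mulr_ge0//.
  rewrite mulrCA -[leRHS]mulr1 ler_wpM2l ?(ltW e0)//.
  by rewrite ler_pdivrMr// mul1r lerDl.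
rewrite EFin_normr_Rintegral//.
apply: (le_trans (le_abse_integral _ _ _)) => //.
  by case/integrableP : ik.
have bE : (\int[mu]_(y in ball a (2 * r)) `|(f y - f a)%:E| =
    (4 * r)%:E * davg f a (2 * r))%E.
  rewrite /davg /iavg /= lebesgue_measure_ball ?(ltW r20)//.
  rewrite inver mulrn_eq0 (gt_eqF r20)/=.
  rewrite muleA -EFinM (_ : 4 * r * _ = 1) ?mul1e//.
  by field; rewrite gt_eqF.
apply: (@le_trans _ _ (\int[mu]_x ((M / r)%:E *
    (fun y => `|(f y - f a)%:E|%E) \_ (ball a (2 * r)) x))%E).
  apply: ge0_le_integral => //.
  - by apply: measurableT_comp => //; case/integrableP : ik.
  - apply: measurable_funeM; apply/(measurable_restrict _ _ _).1 => //.
      exact: measurable_ball.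
    apply: measurable_funTS; do 2 apply: measurableT_comp => //.
  - move=> x _; rewrite patchE; case: ifPn => [_|].
      rewrite -mulrBl -!EFinM lee_fin normrM mulrC distrC ler_wpM2r// HM//.
    rewrite notin_setE /ball/= => /negP; rewrite -leNgt => xar.
    rewrite mule0 mollifier_out// ?mulr0 ?subrr ?normr0//.
    by rewrite distrC (lt_le_trans _ xar)// ltr_pMl// ltr1n.
rewrite ge0_integralZl//; last 3 first.
- apply/(measurable_restrict _ _ _).1 => //; first exact: measurable_ball.
  by apply: measurable_funTS; do 2 apply: measurableT_comp => //.
- by move=> x _; rewrite patchE; case: ifPn.
- by rewrite lee_fin divr_ge0// (ltW r0).
rewrite -integral_mkcond bE muleA -EFinM (_ : M / r * _ = 4 * M)//.
by field; rewrite gt_eqF.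
Unshelve. all: by end_near. Qed.

(** Test against the mollifiers centered at the Lebesgue points of f. *)
Lemma test_ae_eq0 f : L2r f ->
  (forall phi, test_function phi -> \int[mu]_x (f x * phi x) = 0) ->
  f = cst 0 %[ae mu].
Proof.
move=> lf f0.
have := lebesgue_differentiation (locally_integrable_L2r lf).
move/ae_imp; apply => x Lx _.
have /cvg_lim <- // := cvg_mollifier lf Lx.
rewrite (_ : (fun _ => _) = cst 0) ?lim_cst//.
by apply/funext => n; rewrite f0//; apply: test_mollifier; rewrite invr_gt0.
Qed.

End weak.

(** ** Integration of weak derivatives *)

Section ftc.
Context {R : realType}.
Implicit Types (f g k phi : R -> R) (a b x r : R) (D : set R).

Lemma cvg_rstep a x : x != a ->
  (rstep n.+1%:R^-1 a x) @[n --> \oo] --> ((a < x)%R%:R : R).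
Proof.
move=> xa; apply: (@cvg_near_cst _ (R : topologicalType)).
have d0 : 0 < `|x - a| by rewrite normr_gt0 subr_eq0.
near=> n; have rd : n.+1%:R^-1 < `|x - a|.
  by near: n; exact: near_infty_natSinv_lt (PosNum d0).
have r0 : 0 < n.+1%:R^-1 :> R by rewrite invr_gt0.
case: ltgtP xa => // [ax|xa] _; last first.
- have {}rd : n.+1%:R^-1 < a - x by rewrite (lt_le_trans rd)// distrC gtr0_norm ?subr_gt0.
  by apply/eqP; rewrite rstep_le// lerBrDl addrC -lerBrDl ltW.
- have {}rd : n.+1%:R^-1 < x - a by rewrite (lt_le_trans rd)// gtr0_norm ?subr_gt0.
  by apply/eqP; rewrite rstep_ge// -lerBrDl ltW.
Unshelve. all: by end_near. Qed.

Lemma ae_neq a : {ae mu, forall x, x != a}.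
Proof.
exists [set a]; split => //; first exact: lebesgue_measure_set1.
by move=> x /= /negP; rewrite negbK => /eqP.
Qed.

Lemma test_rstepB r a b : 0 < r ->
  test_function (fun x => rstep r a x - rstep r b x).
Proof.
move=> r0; apply: (@test_functionI _ (`|a| + `|b| + r)).
  rewrite (_ : (fun _ => _) = fun x => rstep r a x + -1 * rstep r b x); last first.
    by apply/funext => x; rewrite mulN1r.
  apply: smooth_add; first exact: smooth_rstep.
  by apply: smooth_mul; [exact: smooth_cst|exact: smooth_rstep].
move=> x; have la := ler_norm a; have lb := ler_norm b.
have la' := ler_norm (- a); have lb' := ler_norm (- b).
rewrite !normrN in la' lb'; have [x0|x0] := leP 0 x => xA.
  by rewrite (ger0_norm x0) in xA; rewrite !rstep_ge ?subrr//; lra.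
by rewrite (ltr0_norm x0) in xA; rewrite !rstep_le ?subrr//; lra.
Qed.

(** A weak derivative is integrated between two Lebesgue points: test it
    against smooth approximations of the indicator function of the interval. *)
Lemma rweak_ftc f g a b : a < b -> L2r f -> L2r g -> rweak f g ->
  lebesgue_pt f a -> lebesgue_pt f b ->
  \int[mu]_(x in `[a, b]) g x = f b - f a.
Proof.
move=> ab lf lg fg La Lb.
pose phi n x : R := rstep n.+1%:R^-1 a x - rstep n.+1%:R^-1 b x.
have r0 n : 0 < n.+1%:R^-1 :> R by rewrite invr_gt0.
have tphi n : test_function (phi n) by exact: test_rstepB.
have dphi n x : derive1 (phi n) x =
    mollifier n.+1%:R^-1 a x - mollifier n.+1%:R^-1 b x.
  apply: is_derive_derive1.
  by have := is_deriveB (smooth_is_derive x (@smooth_rstep R n.+1%:R^-1 a))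
    (smooth_is_derive x (@smooth_rstep R n.+1%:R^-1 b)).
have E1 n : \int[mu]_x (f x * derive1 (phi n) x) =
    \int[mu]_x (f x * mollifier n.+1%:R^-1 a x) -
    \int[mu]_x (f x * mollifier n.+1%:R^-1 b x).
  rewrite -RintegralB//; [|exact/L2r_mul/test_L2r/test_mollifier..].
  by congr (Rintegral _ _ _); apply/funext => x; rewrite dphi mulrBr.
(* phi_n' is a difference of mollifiers centered at the Lebesgue points a, b *)
have C1 : \int[mu]_x (f x * derive1 (phi n) x) @[n --> \oo] --> f a - f b.
  under eq_fun do rewrite E1.
  by apply: cvgB; exact: cvg_mollifier.
(* phi_n tends to the indicator of [a, b] off a and b *)
have C2 : \int[mu]_x (g x * phi n x) @[n --> \oo] -->
    \int[mu]_x (g \_ `[a, b]) x.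
  apply: (@Rdominated_cvg _ _ _
    (fun x => 2 * `|(g \_ `[a - 1, b + 1]) x|)).
  - move=> n; apply: measurable_funM; [exact: L2r_meas|exact: test_meas].
  - by apply: rint_meas; exact: L2r_patch_integrable.
  - apply: (ae_imp2 (ae_neq a) (ae_neq b)) => x xa xb.
    rewrite patchE (_ : (if _ then _ else _) = g x * ((a < x)%R%:R - (b < x)%R%:R)).
      apply: cvgM; first exact: cvg_cst.
      by apply: cvgB; exact: cvg_rstep.
    rewrite mem_setE in_itv/= [a <= x]le_eqVlt eq_sym (negbTE xa)/=.
    rewrite [x <= b]leNgt; case: (ltP b x) => bx /=; last first.
      by rewrite andbT subr0; case: ifPn => _; rewrite ?mulr1 ?mulr0.
    by rewrite andbF (lt_trans ab bx) subrr mulr0.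
  - by apply: rintZ; apply: rint_norm; exact: L2r_patch_integrable.
  - move=> n x; rewrite normrM patchE; case: ifPn => [_|].
      rewrite mulrC ler_wpM2r// /phi ler_norml.
      have := rstep_ge0 n.+1%:R^-1 a x; have := rstep_ge0 n.+1%:R^-1 b x.
      have := rstep_le1 n.+1%:R^-1 a x; have := rstep_le1 n.+1%:R^-1 b x.
      by move=> *; apply/andP; split; lra.
    have rn := r0 n; have r1 : n.+1%:R^-1 <= 1 :> R by rewrite invf_le1// ler1n.
    rewrite notin_setE/= in_itv/= => /negP; rewrite negb_and -!ltNge.
    rewrite normr0 mulr0 /phi; move: (n.+1%:R^-1) rn r1 => r rn r1 /orP[xa|bx].
      by rewrite !rstep_le ?subrr ?normr0 ?mulr0//; lra.
    by rewrite !rstep_ge ?subrr ?normr0 ?mulr0//; lra.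
rewrite Rintegral_mkcond.
have C3 : \int[mu]_x (f x * derive1 (phi n) x) @[n --> \oo] -->
    - \int[mu]_x (g \_ `[a, b]) x.
  by under eq_fun do rewrite fg//; exact: cvgN.
have := cvg_unique _ C1 C3 => /(_ (@norm_hausdorff _ _)) H.
by rewrite -[LHS]opprK -H opprB.
Qed.

(** The two iterated integrals of k1(x) k2(y) over the triangle y <= x. *)
Lemma Fubini_triangle (k1 k2 : R -> R) : rint k1 -> rint k2 ->
  let F x := k1 x * \int[mu]_y (if y <= x then k2 y else 0) in
  let G y := k2 y * \int[mu]_x (if y <= x then k1 x else 0) in
  [/\ measurable_fun setT F, measurable_fun setT G &
    \int[mu]_x F x = \int[mu]_y G y].
Proof.
move=> i1 i2 F' G'; have m1 := rint_meas i1; have m2 := rint_meas i2.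
pose G (z : measurableTypeR R * measurableTypeR R) : \bar R :=
  (k1 z.1 * (if z.2 <= z.1 then k2 z.2 else 0))%:E.
have ii1 x : rint (fun y => if y <= x then k2 y else 0).
  apply: (@rint_le _ _ (fun y => `|k2 y|)); last exact: rint_norm.
    by apply: measurable_fun_ifT => //; exact: measurable_fun_ler.
  by move=> y; case: ifPn => // _; rewrite normr0.
have ii2 y : rint (fun x => if y <= x then k1 x else 0).
  apply: (@rint_le _ _ (fun y => `|k1 y|)); last exact: rint_norm.
    by apply: measurable_fun_ifT => //; exact: measurable_fun_ler.
  by move=> x; case: ifPn => // _; rewrite normr0.
have E1 x : (\int[mu]_y G (x, y) =
    (k1 x * \int[mu]_y (if y <= x then k2 y else 0))%:E)%E.
  rewrite /G/= (eq_integral (fun y : measurableTypeR R => (k1 x)%:E *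
     (if (y <= x)%R then k2 y else 0)%:E)%E)//.
  rewrite integralZl//; last exact: ii1.
  rewrite /Rintegral EFinM fineK//.
  by apply: integrable_fin_num => //; exact: ii1.
have E2 y : (\int[mu]_x G (x, y) =
    (k2 y * \int[mu]_x (if y <= x then k1 x else 0))%:E)%E.
  rewrite /G/= (eq_integral (fun x : measurableTypeR R => (k2 y)%:E *
     (if (y <= x)%R then k1 x else 0)%:E)%E); last first.
    by move=> x _; rewrite -EFinM; congr EFin; case: ifPn => _; rewrite ?mulr0// mulrC.
  rewrite integralZl//; last exact: ii2.
  rewrite /Rintegral EFinM fineK//.
  by apply: integrable_fin_num => //; exact: ii2.
have mG : measurable_fun setT G.
  apply/measurable_EFinP; apply: measurable_funM.
    exact: (measurableT_comp m1 measurable_fst).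
  apply: measurable_fun_ifT.
  - by apply: measurable_fun_ler; [exact: measurable_snd|exact: measurable_fst].
  - exact: (measurableT_comp m2 measurable_snd).
  - exact: measurable_cst.
have iG : (mu \x mu)%E.-integrable setT G.
  apply/integrable12ltyP => //.
  apply: (@le_lt_trans _ _ (\int[mu]_x (`|k1 x| * \int[mu]_y `|k2 y|)%:E)%E).
    apply: ge0_le_integral => //=.
    - by move=> x _; exact: integral_ge0.
    - apply: (measurable_fun_fubini_tonelli_F (abse \o G)) => //=.
      exact: measurableT_comp.
    - apply/measurable_EFinP; apply: measurable_funM => //.
      exact: measurableT_comp.
    - move=> x _; rewrite EFinM /Rintegral fineK; last first.
        by apply: integrable_fin_num => //; exact: (rint_norm i2).
      rewrite -ge0_integralZl//; last first.
        by apply/measurable_EFinP; apply: measurableT_comp.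
      apply: ge0_le_integral => //.
      - apply: measurableT_comp => //.
        apply: measurableT_comp => //; apply: measurable_funM => //.
        by apply: rint_meas; exact: ii1.
      - apply: measurable_funeM; apply/measurable_EFinP.
        exact: measurableT_comp.
      - move=> y _; rewrite /G /= -EFinM lee_fin normrM ler_wpM2l//.
        by case: ifPn => // _; rewrite normr0.
  have iC : rint (fun x => (\int[mu]_y `|k2 y|) * `|k1 x|).
    by apply: rintZ; exact: rint_norm.
  have := integrable_lty measurableT iC; apply: le_lt_trans.
  rewrite le_eqVlt; apply/orP; left; apply/eqP; apply: eq_integral => x _.
  by rewrite mulrC.
split.
- apply/measurable_EFinP; have := measurable_fubini_F iG.
  by congr (measurable_fun _ _); apply/funext => x; exact: E1.
- apply/measurable_EFinP; have := measurable_fubini_G iG.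
  by congr (measurable_fun _ _); apply/funext => y; exact: E2.
- congr fine; transitivity (\int[mu]_x \int[mu]_y G (x, y))%E.
    by apply: eq_integral => x _; rewrite E1.
  by rewrite (Fubini iG); apply: eq_integral => y _; rewrite E2.
Qed.

End ftc.

(** * Integration by parts and boundedness *)

Section parts.
Context {R : realType}.
Implicit Types (f g k phi : R -> R) (a b x r : R) (D : set R).

Lemma L2r_patch g a b : L2r g -> L2r (g \_ `[a, b]).
Proof.
move=> lg; have -> : g \_ `[a, b] = (fun x => \1_`[a, b] x * g x).
  by apply/funext => x; rewrite patchE indicE; case: ifPn; rewrite ?mul1r ?mul0r.
apply: (@L2r_bounded_mul _ 1) => //.
by move=> x; rewrite indicE; case: (_ \in _); rewrite ?normr1 ?normr0.
Qed.

(** The product rule, between common Lebesgue points, for functions with weak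
    derivatives: integrate g1(x) g2(y) over both triangles of the square. *)
Lemma rweak_product f1 g1 f2 g2 a b : a < b ->
  L2r f1 -> L2r g1 -> rweak f1 g1 -> L2r f2 -> L2r g2 -> rweak f2 g2 ->
  lebesgue_pt f1 a -> lebesgue_pt f2 a -> lebesgue_pt f1 b -> lebesgue_pt f2 b ->
  \int[mu]_(x in `[a, b]) (g1 x * f2 x + f1 x * g2 x) =
  f1 b * f2 b - f1 a * f2 a.
Proof.
move=> ab lf1 lg1 w1 lf2 lg2 w2 L1a L2a L1b L2b.
set k1 := g1 \_ `[a, b]; set k2 := g2 \_ `[a, b].
have lk1 : L2r k1 by exact: L2r_patch.
have lk2 : L2r k2 by exact: L2r_patch.
have ik1 : rint k1 by exact: L2r_patch_integrable.
have ik2 : rint k2 by exact: L2r_patch_integrable.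
have [mF mG FG] := Fubini_triangle ik1 ik2.
have mf1 := L2r_meas lf1; have mf2 := L2r_meas lf2.
have mk1 := L2r_meas lk1; have mk2 := L2r_meas lk2.
have LF : \int[mu]_x (k1 x * \int[mu]_y (if y <= x then k2 y else 0)) =
    \int[mu]_x (k1 x * f2 x - f2 a * k1 x).
  apply: eq_Rintegral_ae; [exact: measurableT|exact: mF| |].
    by apply: measurable_funB; exact: measurable_funM.
  apply: (ae_imp2 (ae_neq a)
    (lebesgue_differentiation (locally_integrable_L2r lf2))) => x xa L2x _.
  rewrite /k1 patchE; case: ifPn => [|_]; last by rewrite !mul0r mulr0 subr0.
  rewrite inE/= in_itv/= => /andP[ax xb].
  have {}ax : a < x by rewrite lt_neqAle eq_sym xa.
  rewrite [f2 a * _]mulrC -mulrBr; congr (_ * _).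
  rewrite -(rweak_ftc ax lf2 lg2 w2 L2a L2x) [RHS]Rintegral_mkcond.
  congr (Rintegral _ _ _); apply/funext => y; rewrite /k2 !patchE !mem_setE !in_itv/=.
  case: (leP y x) => yx; last by rewrite andbF.
  by rewrite (le_trans yx xb).
have LG : \int[mu]_y (k2 y * \int[mu]_x (if y <= x then k1 x else 0)) =
    \int[mu]_y (f1 b * k2 y - f1 y * k2 y).
  apply: eq_Rintegral_ae; [exact: measurableT|exact: mG| |].
    by apply: measurable_funB; exact: measurable_funM.
  apply: (ae_imp2 (ae_neq b)
    (lebesgue_differentiation (locally_integrable_L2r lf1))) => y yb L1y _.
  rewrite /k2 patchE; case: ifPn => [|_]; last by rewrite mul0r !mulr0 subr0.
  rewrite inE/= in_itv/= => /andP[ay {}yb'].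
  have {}yb : y < b by rewrite lt_neqAle yb.
  rewrite -mulrBl mulrC; congr (_ * _).
  rewrite -(rweak_ftc yb lf1 lg1 w1 L1y L1b) [RHS]Rintegral_mkcond.
  congr (Rintegral _ _ _); apply/funext => x; rewrite /k1 !patchE !mem_setE !in_itv/=.
  case: (leP y x) => yx; last by [].
  by rewrite (le_trans ay yx).
have E1 : \int[mu]_x k1 x = f1 b - f1 a.
  by rewrite -(rweak_ftc ab lf1 lg1 w1 L1a L1b) [RHS]Rintegral_mkcond.
have E2 : \int[mu]_x k2 x = f2 b - f2 a.
  by rewrite -(rweak_ftc ab lf2 lg2 w2 L2a L2b) [RHS]Rintegral_mkcond.
have i12 : rint (fun x => k1 x * f2 x) by exact: L2r_mul.
have i21 : rint (fun x => f1 x * k2 x) by exact: L2r_mul.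
move: FG; rewrite LF LG (RintegralB _ i12)//; last exact: rintZ.
rewrite (RintegralB _ _ i21)//; last exact: rintZ.
rewrite (RintegralZl _ _ ik1)// (RintegralZl _ _ ik2)// E1 E2 => FG.
rewrite Rintegral_mkcond.
rewrite (_ : _ \_ _ = (fun x => k1 x * f2 x + f1 x * k2 x)); last first.
  apply/funext => x; rewrite /k1 /k2 !patchE; case: ifPn => // _.
  by rewrite mul0r mulr0 addr0.
rewrite (RintegralD measurableT i12 i21); lra.
Qed.

(** An integrable function takes small values in every long enough interval,
    and at points of any given set of full measure. *)
Lemma integrable_small_point (P : R -> R) (e : R) (E : R -> Prop) :
  rint P -> 0 < e -> {ae mu, forall x, E x} ->
  exists2 K, 0 < K & forall c, exists x, [/\ c <= x <= c + K, E x & `|P x| < e].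
Proof.
move=> iP e0 aE; set C := \int[mu]_x `|P x|.
have C0 : 0 <= C by exact: Rintegral_ge0.
(* if |P| >= e on an interval of length K, then e K is at most the L^1 norm C *)
exists ((C + 1) / e); first by rewrite divr_gt0// ltr_wpDl.
set K := _ / e => c; apply: contrapT => H.
have K0 : 0 < K by rewrite divr_gt0// ltr_wpDl.
have iP' : mu.-integrable `[c, c + K] (EFin \o (fun x => `|P x|)).
  by apply: rintS => //; exact: rint_norm.
suff : e * K <= C by rewrite /K mulrC divfK ?gt_eqF// gerDl ler10.
apply: (@le_trans _ _ (\int[mu]_(x in `[c, c + K]) `|P x|)); last first.
  rewrite Rintegral_mkcond; apply: le_Rintegral => //.
  - rewrite -restrict_EFin; apply: (integrable_mkcond _ _).1 => //.
  - exact: rint_norm.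
  - by move=> x _; rewrite patchE; case: ifPn => // _; exact: normr_ge0.
rewrite -lee_fin /Rintegral fineK; last exact: integrable_fin_num.
apply: (@le_trans _ _ (\int[mu]_(x in `[c, (c + K)%R]) e%:E)%E).
  rewrite integral_cst//= lebesgue_measure_itv/= lte_fin ltrDl K0.
  by rewrite -EFinB -EFinM addrAC subrr add0r.
apply: ae_ge0_le_integral => //.
- by move=> x _; rewrite lee_fin ltW.
- by case/integrableP : iP'.
- apply: (ae_imp aE) => x Ex /=; rewrite in_itv/= => xc.
  by rewrite lee_fin leNgt; apply/negP => Px; apply: H; exists x.
Qed.

(** The product f1 f2 is integrable, hence small at Lebesgue points x_n and y_n
    tending to plus and minus infinity; let n tend to infinity in the product
    rule between y_n and x_n. *)
Lemma rweak_parts f1 g1 f2 g2 :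
  L2r f1 -> L2r g1 -> rweak f1 g1 -> L2r f2 -> L2r g2 -> rweak f2 g2 ->
  \int[mu]_x (f1 x * g2 x) = - \int[mu]_x (g1 x * f2 x).
Proof.
move=> lf1 lg1 w1 lf2 lg2 w2.
pose h x := g1 x * f2 x + f1 x * g2 x; pose P x := f1 x * f2 x.
have ih : rint h by apply: rintD; exact: L2r_mul.
have iP : rint P by exact: L2r_mul.
pose E x := lebesgue_pt f1 x /\ lebesgue_pt f2 x.
have aE : {ae mu, forall x, E x}.
  by apply: (ae_imp2 (lebesgue_differentiation (locally_integrable_L2r lf1))
    (lebesgue_differentiation (locally_integrable_L2r lf2))).
have pts n : exists xy : R * R, [/\ n.+1%:R <= xy.1 /\ xy.2 <= - n.+1%:R,
    E xy.1, E xy.2, `|P xy.1| < n.+1%:R^-1 & `|P xy.2| < n.+1%:R^-1].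
  have n0 : 0 < n.+1%:R^-1 :> R by rewrite invr_gt0.
  have [K K0 HK] := integrable_small_point iP n0 aE.
  have [x [/andP[nx _] Ex Px]] := HK n.+1%:R.
  have [y [/andP[_ yn] Ey Py]] := HK (- n.+1%:R - K).
  by exists (x, y); split => //=; split => //; rewrite subrK in yn.
have [xy Hxy] := choice pts.
have C1 : \int[mu]_x (h \_ `[(xy n).2, (xy n).1]) x @[n --> \oo] -->
    \int[mu]_x h x.
  apply: (@Rdominated_cvg _ _ _ (fun x => `|h x|)).
  - move=> n; apply/(measurable_restrict _ _ _).1 => //.
    by apply: measurable_funTS; exact: rint_meas.
  - exact: rint_meas.
  - apply: aeW => x; apply: (@cvg_near_cst _ (R : topologicalType)).
    near=> n; have [[nx yn] _ _ _ _] := Hxy n.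
    have xn : `|x| <= n.+1%:R.
      have : `|x| <= n%:R by near: n; exact: nbhs_infty_ger.
      by move=> /le_trans; apply; rewrite ler_nat.
    rewrite patchE mem_setE in_itv/= ifT//.
    move: xn; rewrite ler_norml => /andP[H1 H2].
    by rewrite (le_trans yn H1) (le_trans H2 nx).
  - exact: rint_norm.
  - by move=> n x; rewrite patchE; case: ifPn => // _; rewrite normr0.
have C2 : \int[mu]_x (h \_ `[(xy n).2, (xy n).1]) x @[n --> \oo] --> (0 : R).
  apply/cvgrPdist_le => e e0; near=> n.
  have [[nx yn] [L1x L2x] [L1y L2y] Px Py] := Hxy n.
  have n0 : 0 < n.+1%:R :> R by [].
  have yx : (xy n).2 < (xy n).1 by lra.
  rewrite -Rintegral_mkcond rweak_product//.
  rewrite sub0r normrN (le_trans (ler_normB _ _))//.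
  have : n.+1%:R^-1 < e / 2.
    by near: n; apply: near_infty_natSinv_lt (PosNum (divr_gt0 e0 (ltr0n _ 2))).
  by move: (n.+1%:R^-1) Px Py => r; rewrite /P; lra.
have H : \int[mu]_x h x = 0 := cvg_unique (@norm_hausdorff _ _) C1 C2.
apply/eqP; rewrite -addr_eq0 addrC -RintegralD//; [|exact: L2r_mul..].
by apply/eqP; exact: H.
Unshelve. all: by end_near. Qed.

(** There is K such that every point has, at distance at most K, a Lebesgue point
    of f where |f| <= 1; between the two, f varies by at most
    \int |g| <= \int (1 + g^2) <= K + \int g^2. *)
Lemma rweak_bounded f g : L2r f -> L2r g -> rweak f g ->
  exists2 M, 0 <= M & {ae mu, forall x, `|f x| <= M}.
Proof.
move=> lf lg fg; have if2 := L2r_sqr lf; have ig2 := L2r_sqr lg.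
have aE := lebesgue_differentiation (locally_integrable_L2r lf).
have [K K0 HK] := integrable_small_point if2 ltr01 aE.
have C0 : 0 <= \int[mu]_x g x ^+ 2.
  by apply: Rintegral_ge0 => x _; exact: sqr_ge0.
exists (1 + (K + \int[mu]_x g x ^+ 2)).
  by rewrite addr_ge0// addr_ge0// ltW.
apply: (ae_imp aE) => x Lx.
have [y [/andP[xy yxK] Ly fy]] := HK x.
have {}fy : `|f y| <= 1.
  by move: fy; rewrite normrX => /ltW; rewrite expr_le1.
move: xy; rewrite le_eqVlt => /predU1P[->|xy].
  by rewrite (le_trans fy)// lerDl addr_ge0// ltW.
have -> : f x = f y - (f y - f x) by rewrite opprB addrC subrK.
rewrite -(rweak_ftc xy lf lg fg)// (le_trans (ler_normB _ _))// lerD//.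
have ig : mu.-integrable `[x, y] (EFin \o g) by exact: L2r_integrable_itv.
have i1 : mu.-integrable `[x, y] (EFin \o cst (1 : R)).
  apply: continuous_compact_integrable; first exact: segment_compact.
  by apply: continuous_subspaceT => z; exact: cvg_cst.
have i2 : mu.-integrable `[x, y] (EFin \o (fun x => g x ^+ 2)).
  exact: rintS.
apply: (le_trans (le_normr_Rintegral _ _)) => //.
apply: (@le_trans _ _ (\int[mu]_(z in `[x, y]) (1 + g z ^+ 2))).
  apply: le_Rintegral => //.
  - exact: integrable_norm.
  - rewrite (_ : _ \o _ = (EFin \o cst 1) \+ (EFin \o fun x => g x ^+ 2))//.
    exact: integrableD.
  - move=> z _; rewrite -(real_normK (num_real (g z))); set t := `|g z|.
    by have := sqr_ge0 (t - 2^-1); nra.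
rewrite RintegralD// lerD//.
  rewrite Rintegral_cst//= lebesgue_measure_itv/= lte_fin xy.
  by rewrite mul1r lerBlDl.
rewrite Rintegral_mkcond; apply: le_Rintegral => //.
  by rewrite -restrict_EFin; apply: (integrable_mkcond _ _).1.
by move=> z _; rewrite patchE; case: ifPn => // _; exact: sqr_ge0.
Qed.

End parts.

(** * Differentiation of the potential energy *)

Section potential.
Context {R : realType}.

Implicit Types a b c d s q : R.

(** The squared modulus of the complex number (a + s b) + i (c + s d). *)
Definition sqnorm_line (a b c d s : R) := (a + s * b) ^+ 2 + (c + s * d) ^+ 2.

Lemma sqnorm_line_ge0 a b c d s : 0 <= sqnorm_line a b c d s.
Proof. by rewrite addr_ge0// sqr_ge0. Qed.

Lemma is_derive_sqnorm_line a b c d s : is_derive s 1 (sqnorm_line a b c d)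
  (2 * ((a + s * b) * b + (c + s * d) * d)).
Proof.
have A x y : is_derive s 1 (fun s => (x + s * y) ^+ 2) (2 * (x + s * y) * y).
  have -> : (fun s => (x + s * y) ^+ 2) = (fun s => (y * s + x) ^+ 2).
    by apply/funext => z; rewrite addrC mulrC.
  have := is_derive_expr 2 (is_derive_affine y x s).
  by rewrite expr1 [y * s]mulrC [s * y + x]addrC.
have := is_derive_add (A a b) (A c d); congr (is_derive _ _ _ _).
by ring.
Qed.

Lemma is_derive_powR_sqnorm0 a b c d q : 1 < q ->
  is_derive (0 : R) 1 (fun s => sqnorm_line a b c d s `^ q)
  (2 * q * sqnorm_line a b c d 0 `^ (q - 1) * (a * b + c * d)).
Proof.
move=> q1; have q0 : 0 < q by rewrite (lt_trans _ q1).
have [N0|N0] := eqVneq (sqnorm_line a b c d 0) 0.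
  (* at a zero the function is (s^2 (b^2 + d^2))^q, which is O(s^2) *)
  rewrite N0 powR0; last by rewrite subr_eq0 gt_eqF.
  rewrite mulr0 mul0r.
  move: N0 => /eqP; rewrite /sqnorm_line !mul0r !addr0.
  rewrite paddr_eq0 ?sqr_ge0// !sqrf_eq0 => /andP[/eqP-> /eqP->].
  apply: (@is_derive_quadratic _ _ ((b ^+ 2 + d ^+ 2) `^ q)) => h h1.
  rewrite !add0r !exprMn -mulrDr powRM ?sqr_ge0 ?addr_ge0 ?sqr_ge0//.
  rewrite mulrC ger0_norm ?mulr_ge0 ?powR_ge0// ler_wpM2l ?powR_ge0//.
  have [->|h0] := eqVneq h 0.
    by rewrite expr0n powR0 ?gt_eqF.
  rewrite -{1}[q](subrK 1) powRD; last by rewrite sqrf_eq0 h0 implybT.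
  rewrite powRr1 ?sqr_ge0// ler_piMl ?sqr_ge0//.
  apply: (@le_trans _ _ (1 `^ (q - 1))); last by rewrite powR1.
  rewrite ge0_ler_powR ?nnegrE ?sqr_ge0 ?subr_ge0 ?(ltW q1)//.
  by rewrite -real_normK ?num_real// exprn_ile1.
have Np : 0 < sqnorm_line a b c d 0 by rewrite lt_neqAle eq_sym N0 sqnorm_line_ge0.
have := @is_derive1_comp _ (@powR R ^~ q) (sqnorm_line a b c d) 0 _ _
  (is_derive1_powR q Np) (is_derive_sqnorm_line a b c d 0).
by congr (is_derive _ _ _ _); rewrite !mul0r !addr0; ring.
Qed.

Lemma is_derive_powR_sqnorm a b c d q s : 1 < q ->
  is_derive s 1 (fun s => sqnorm_line a b c d s `^ q)
  (2 * q * sqnorm_line a b c d s `^ (q - 1) *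
    ((a + s * b) * b + (c + s * d) * d)).
Proof.
move=> q1; have H := is_derive_powR_sqnorm0 (a + s * b) b (c + s * d) d q1.
have E h : sqnorm_line (a + s * b) b (c + s * d) d (1 * h + - s) =
    sqnorm_line a b c d h.
  by rewrite /sqnorm_line; congr (_ ^+ 2 + _ ^+ 2); ring.
rewrite -{1}(subrr s) -{1}(mul1r s) in H.
have := is_derive_comp_affine H; rewrite mulr1.
have -> : sqnorm_line (a + s * b) b (c + s * d) d 0 = sqnorm_line a b c d s.
  by rewrite -(E s) mul1r subrr.
congr (is_derive _ _ _ _); apply/funext => h; congr (_ `^ _); exact: E.
Qed.

Lemma sqnorm_line_le (M : R) a b c d s :
  `|a| <= M -> `|b| <= M -> `|c| <= M -> `|d| <= M ->
  sqnorm_line a b c d s <= 2 * (M + `|s| * M) ^+ 2.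
Proof.
move=> aM bM cM dM; have M0 : 0 <= M by exact: le_trans aM.
have H x y : `|x| <= M -> `|y| <= M -> (x + s * y) ^+ 2 <= (M + `|s| * M) ^+ 2.
  move=> xM yM; rewrite -(real_normK (num_real (x + _))).
  rewrite lerXn2r// ?nnegrE ?addr_ge0 ?mulr_ge0//.
  by rewrite (le_trans (ler_normD _ _))// lerD// normrM ler_wpM2l.
by rewrite mulr2n mulrDl mul1r lerD// H.
Qed.

(** The components a + i c and b + i d of the line are bounded by M everywhere. *)
Section integral.
Variables (a b c d : R -> R) (M q : R).
Hypotheses (la : L2r a) (lb : L2r b) (lc : L2r c) (ld : L2r d).
Hypotheses (aM : forall x, `|a x| <= M) (bM : forall x, `|b x| <= M).
Hypotheses (cM : forall x, `|c x| <= M) (dM : forall x, `|d x| <= M).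
Hypothesis q1 : 1 < q.

Let N s x := sqnorm_line (a x) (b x) (c x) (d x) s.

Let N_ge0 s x : 0 <= N s x. Proof. exact: sqnorm_line_ge0. Qed.

Let powRN_le s x : N s x `^ (q - 1) <= (2 * (M + `|s| * M) ^+ 2) `^ (q - 1).
Proof.
rewrite ge0_ler_powR ?nnegrE ?subr_ge0 ?(ltW q1)//.
- by rewrite mulr_ge0// sqr_ge0.
- exact: sqnorm_line_le.
Qed.

Let integrable_N s : rint (N s).
Proof.
by apply: rintD; apply: L2r_sqr; apply: L2r_add => //; exact: L2r_scale.
Qed.

Lemma integrable_powR_sqnorm s : rint (fun x => N s x `^ q).
Proof.
apply: (@rint_le _ _ (fun x => (2 * (M + `|s| * M) ^+ 2) `^ (q - 1) * N s x)).
- apply: (measurableT_comp (measurable_powR q)).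
  by apply: rint_meas; exact: integrable_N.
- move=> x; rewrite ger0_norm ?powR_ge0// -{1}[q](subrK 1).
  have [->|N0] := eqVneq (N s x) 0.
    by rewrite subrK powR0 ?mulr0// gt_eqF// (lt_trans _ q1).
  rewrite (@powRD _ _ (q - 1)) ?N0 ?implybT//.
  by rewrite powRr1// ler_wpM2r// ?N_ge0// powRN_le.
- by apply: rintZ; exact: integrable_N.
Qed.

Lemma is_derive_integral_powR_sqnorm :
  is_derive (0 : R) 1 (fun s => \int[mu]_x (N s x `^ q))
  (\int[mu]_x (2 * q * (a x ^+ 2 + c x ^+ 2) `^ (q - 1) *
     (a x * b x + c x * d x))).
Proof.
have q0 : 0 < q by rewrite (lt_trans _ q1).
have M0 : 0 <= M by exact: le_trans (aM 0).
have dN s x : is_derive s 1 (fun s => N s x `^ q) (2 * q * N s x `^ (q - 1) *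
    ((a x + s * b x) * b x + (c x + s * d x) * d x)).
  exact: is_derive_powR_sqnorm.
(* for |s| < 1 the squared modulus is at most 2 (2 M)^2 *)
pose C := (2 * (M + 1 * M) ^+ 2) `^ (q - 1).
pose B x := (`|a x| + `|b x|) * `|b x| + (`|c x| + `|d x|) * `|d x|.
have B0 x : 0 <= B x by rewrite addr_ge0// mulr_ge0// addr_ge0.
have L2r_norm f : L2r f -> L2r (fun x => `|f x|).
  move=> lf; apply: L2rP.
    by apply: measurableT_comp => //; exact: L2r_meas.
  rewrite (_ : _ \o _ = EFin \o (fun x => f x ^+ 2)); first exact: L2r_sqr.
  by apply/funext => x /=; rewrite real_normK// num_real.
have iB : rint B.
  by apply: rintD; apply: L2r_mul; try apply: L2r_add; exact: L2r_norm.
have I0 : `]-1, 1[%classic (0 : R) by rewrite /= in_itv/= oppr_lt0 ltr01.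
have iN s : `]-1, 1[%classic s -> rint (fun x => N s x `^ q).
  by move=> _; exact: integrable_powR_sqnorm.
have df s x : `]-1, 1[%classic s -> setT x -> derivable (fun s => N s x `^ q) s 1.
  by move=> _ _; case: (dN s x).
have G0 x : 0 <= 2 * q * C * B x.
  by rewrite !mulr_ge0// ?powR_ge0// ltW.
have iG : rint (fun x => 2 * q * C * B x) by exact: rintZ.
have ub s x : `]-1, 1[%classic s -> setT x ->
    `|partial1of2 (fun s x => N s x `^ q) s x| <= 2 * q * C * B x.
  rewrite /= in_itv/= -ltr_norml => s1 _.
  rewrite /partial1of2 (is_derive_derive1 (dN s x)) normrM ler_pM//.
    rewrite ger0_norm; last by rewrite !mulr_ge0// ?powR_ge0// ltW.
    rewrite ler_wpM2l; [|by rewrite mulr_ge0// ltW|] => //.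
    apply: (le_trans (powRN_le s x)).
    have HM : 2 * (M + `|s| * M) ^+ 2 <= 2 * (M + 1 * M) ^+ 2.
      rewrite ler_wpM2l// lerXn2r// ?nnegrE ?addr_ge0 ?mulr_ge0//.
      by rewrite lerD2l ler_wpM2r// ltW.
    by apply: ge0_ler_powR => //; rewrite ?nnegrE ?subr_ge0 ?(ltW q1)//;
      apply: mulr_ge0 => //; exact: sqr_ge0.
  have H y z : `|(y + s * z) * z| <= (`|y| + `|z|) * `|z|.
    rewrite normrM ler_wpM2r// (le_trans (ler_normD _ _))// lerD2l normrM.
    by rewrite ler_piMl// ltW.
  by rewrite (le_trans (ler_normD _ _))// lerD.
have D := derivable_under_integral measurableT I0 iN df G0 iG ub.
have E := differentiation_under_integral measurableT I0 iN df G0 iG ub.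
apply: DeriveDef; first exact: D.
rewrite -derive1E E; congr (Rintegral _ _ _); apply/funext => x.
by rewrite /partial1of2 (is_derive_derive1 (dN 0 x)) /N /sqnorm_line !mul0r !addr0.
Qed.

End integral.

End potential.

(** * Complex-valued functions, componentwise *)

Section complex_functions.
Context {R : realType}.
Implicit Types (f g k phi : R -> R) (a b x r s : R) (u v w xi : R -> R[i]).

(** The real function f is in H^1 with weak derivative g. *)
Definition rH1 f g := [/\ L2r f, L2r g & rweak f g].

Lemma rH1_comb a f g f' g' : rH1 f g -> rH1 f' g' ->
  rH1 (fun x => f x + a * f' x) (fun x => g x + a * g' x).
Proof.
move=> [lf lg fg] [lf' lg' fg']; split.
- by apply: L2r_add => //; exact: L2r_scale.
- by apply: L2r_add => //; exact: L2r_scale.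
move=> phi tphi; have tphi' := test_derive1 tphi.
have lphi := test_L2r tphi; have lphi' := test_L2r tphi'.
have E f1 f2 k : L2r f1 -> L2r f2 -> L2r k ->
    \int[mu]_x ((f1 x + a * f2 x) * k x) =
    \int[mu]_x (f1 x * k x) + a * \int[mu]_x (f2 x * k x).
  move=> l1 l2 lk; rewrite -RintegralZl//; last exact: L2r_mul.
  rewrite -RintegralD//; [|exact: L2r_mul|by apply: rintZ; exact: L2r_mul].
  by congr (Rintegral _ _ _); apply/funext => x; rewrite mulrDl mulrA.
by rewrite !E// fg// fg'// mulrN opprD.
Qed.

Lemma rH1_uniq f g g' : rH1 f g -> rH1 f g' -> g = g' %[ae mu].
Proof.
move=> [lf lg fg] [_ lg' fg'].
have ld : L2r (fun x => g x + -1 * g' x).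
  by apply: L2r_add => //; exact: L2r_scale.
have : (fun x => g x + -1 * g' x) = cst 0 %[ae mu].
  apply: test_ae_eq0 => // phi tphi; have lphi := test_L2r tphi.
  rewrite (_ : (fun _ => _) = (fun x => g x * phi x - g' x * phi x)); last first.
    by apply/funext => x; ring.
  rewrite RintegralB//; [|exact: L2r_mul..].
  apply/eqP; rewrite subr_eq0; apply/eqP; apply: oppr_inj.
  by rewrite -fg// -fg'.
move=> /ae_imp; apply => x /(_ I)/= /eqP.
by rewrite mulN1r subr_eq0 => /eqP.
Qed.

Lemma rH1_test phi : test_function phi -> rH1 phi (derive1 phi).
Proof.
move=> tphi; split; first exact: test_L2r.
- exact/test_L2r/test_derive1.
- exact: rweak_test.
Qed.

Lemma rH1_cst0 : rH1 (cst 0) (cst 0).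
Proof.
have l0 : L2r (cst 0 : R -> R).
  apply: L2rP => //; rewrite (_ : _ \o _ = cst 0%E); first exact: integrable0.
  by apply/funext => x /=; rewrite expr0n.
split => // phi _.
have E k : \int[mu]_x (cst (0:R) x * k x) = 0 :> R.
  rewrite (_ : (fun _ => _) = cst 0); first by rewrite Rintegral_cst// mul0r.
  by apply/funext => x /=; rewrite mul0r.
by rewrite !E oppr0.
Qed.

(** A pointwise bounded representative of an essentially bounded function. *)
Lemma bounded_representative M f : 0 <= M -> L2r f ->
  {ae mu, forall x, `|f x| <= M} ->
  exists f', [/\ L2r f', forall x, `|f' x| <= M & f = f' %[ae mu] ].
Proof.
move=> M0 lf fM; exists (fun x => if `|f x| <= M then f x else 0).
have mf := L2r_meas lf.
have ff : f = (fun x => if `|f x| <= M then f x else 0) %[ae mu].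
  by apply: (ae_imp fM) => x -> _.
split => //.
- apply: (L2r_ae _ ff) => //.
  apply: measurable_fun_ifT => //; apply: measurable_fun_ler => //.
  exact: measurableT_comp.
- by move=> x; case: ifPn => // _; rewrite normr0.
Qed.

(** The squared modulus of a complex number. *)
Definition sqnormc (z : R[i]) : R := reC z ^+ 2 + imC z ^+ 2.

Lemma sqnormc_ge0 z : 0 <= sqnormc z.
Proof. by rewrite addr_ge0// sqr_ge0. Qed.

Lemma normcE z : Normc.normc z = Num.sqrt (sqnormc z).
Proof. by case: z. Qed.

Lemma normc_powR z r : Normc.normc z `^ r = sqnormc z `^ (2^-1 * r).
Proof. by rewrite normcE -powR12_sqrt ?sqnormc_ge0// powRrM. Qed.

Lemma distrE u phi : distr u phi =
  (\int[mu]_x (reC (u x) * phi x)) +i* (\int[mu]_x (imC (u x) * phi x)).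
Proof.
rewrite /distr /Cintegral; congr (_ +i* _); congr (Rintegral _ _ _);
  apply/funext => x; case: (u x) => a b /=.
  by rewrite mulr0 subr0.
by rewrite mulr0 add0r.
Qed.

Lemma weak_derivativeP u (g : R -> R[i]) : weak_derivative u g <->
  rweak (fun x => reC (u x)) (fun x => reC (g x)) /\
  rweak (fun x => imC (u x)) (fun x => imC (g x)).
Proof.
split=> [H|[Hr Hi] phi tphi].
  split=> phi tphi; have := H phi tphi; rewrite /Ddistr !distrE => -[Hr Hi].
    by rewrite -Hr opprK.
  by rewrite -Hi opprK.
rewrite /Ddistr !distrE Hr// Hi//.
by apply/eqP; rewrite eq_complex/= !opprK !eqxx.
Qed.

(** The chosen representative [Dx u] is indeed a weak derivative when u is in
    H^1. *)
Lemma H1_Dx u : H1 u -> L2 (Dx u) /\ weak_derivative u (Dx u).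
Proof.
move=> [_ [g lg ug]].
by apply: (@xgetPex _ (fun=> 0) [set g | L2 g /\ weak_derivative u g]); exists g. Qed.

Lemma H1_re u : H1 u -> rH1 (fun x => reC (u x)) (fun x => reC (Dx u x)).
Proof.
move=> H; have [[lr li] /weak_derivativeP[wr wi]] := H1_Dx H.
by have [[? ?] _] := H; split.
Qed.

Lemma H1_im u : H1 u -> rH1 (fun x => imC (u x)) (fun x => imC (Dx u x)).
Proof.
move=> H; have [[lr li] /weak_derivativeP[wr wi]] := H1_Dx H.
by have [[? ?] _] := H; split.
Qed.

Lemma H1I u f g : rH1 (fun x => reC (u x)) f -> rH1 (fun x => imC (u x)) g ->
  H1 u.
Proof.
move=> [lr lf wr] [li lg wi]; split; first by [].
exists (fun x => f x +i* g x); first by [].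
by apply/weak_derivativeP.
Qed.

Lemma Dx_ae u f g : H1 u ->
  rH1 (fun x => reC (u x)) f -> rH1 (fun x => imC (u x)) g ->
  {ae mu, forall x, reC (Dx u x) = f x /\ imC (Dx u x) = g x}.
Proof.
move=> H Hf Hg.
apply: (ae_imp2 (rH1_uniq (H1_re H) Hf) (rH1_uniq (H1_im H) Hg)) => x.
by move=> /(_ I) ? /(_ I) ?.
Qed.

Lemma re_lineE u s v x :
  reC (addC_fun u (scaleC_fun s v) x) = reC (u x) + s * reC (v x).
Proof.
by rewrite /addC_fun /scaleC_fun; case: (u x) (v x) => a b [c d] /=; rewrite mul0r subr0.
Qed.

Lemma im_lineE u s v x :
  imC (addC_fun u (scaleC_fun s v) x) = imC (u x) + s * imC (v x).
Proof.
by rewrite /addC_fun /scaleC_fun; case: (u x) (v x) => a b [c d] /=; rewrite mul0r addr0.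
Qed.

Lemma re_line_rH1 u s v : H1 u -> H1 v ->
  rH1 (fun x => reC (addC_fun u (scaleC_fun s v) x))
    (fun x => reC (Dx u x) + s * reC (Dx v x)).
Proof.
move=> Hu Hv; have := rH1_comb s (H1_re Hu) (H1_re Hv).
by congr (rH1 _ _); apply/funext => x; rewrite re_lineE.
Qed.

Lemma im_line_rH1 u s v : H1 u -> H1 v ->
  rH1 (fun x => imC (addC_fun u (scaleC_fun s v) x))
    (fun x => imC (Dx u x) + s * imC (Dx v x)).
Proof.
move=> Hu Hv; have := rH1_comb s (H1_im Hu) (H1_im Hv).
by congr (rH1 _ _); apply/funext => x; rewrite im_lineE.
Qed.

Lemma H1_line u s v : H1 u -> H1 v -> H1 (addC_fun u (scaleC_fun s v)).
Proof.
by move=> Hu Hv; apply: H1I; [exact: re_line_rH1|exact: im_line_rH1].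
Qed.

Lemma H1_mulI v : H1 v -> H1 (fun x => iC * v x).
Proof.
move=> H; apply: (@H1I _ (fun x => 0 + -1 * imC (Dx v x)) (fun x => reC (Dx v x))).
  have := rH1_comb (-1) rH1_cst0 (H1_im H); congr (rH1 _ _); apply/funext => x.
  by case: (v x) => a b /=; rewrite mulN1r mul0r mul1r.
have := H1_re H; congr (rH1 _ _); apply/funext => x.
by case: (v x) => a b /=; rewrite mul0r mul1r add0r.
Qed.

Lemma H1_real phi : test_function phi -> H1 (fun x => (phi x)%:C).
Proof.
by move=> tphi; apply: (@H1I _ (derive1 phi) (cst 0)); [exact: rH1_test|exact: rH1_cst0].
Qed.

Lemma innerE u v : inner u v =
  \int[mu]_x (reC (u x) * reC (v x) + imC (u x) * imC (v x)).
Proof.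
rewrite /inner /Cintegral /=; congr (Rintegral _ _ _); apply/funext => x.
by case: (u x) (v x) => a b [c d] /=; rewrite mulrN opprK.
Qed.

Lemma omegaE u v : omega u v =
  \int[mu]_x (imC (u x) * reC (v x) - reC (u x) * imC (v x)).
Proof.
rewrite /omega innerE; congr (Rintegral _ _ _); apply/funext => x.
by case: (u x) (v x) => a b [c d] /=; ring.
Qed.

Lemma integrable_pairing u v : L2 u -> L2 v ->
  rint (fun x => reC (u x) * reC (v x) + imC (u x) * imC (v x)).
Proof. by move=> [ur ui] [vr vi]; apply: rintD; exact: L2r_mul. Qed.

End complex_functions.

(** * The differential of the Hamiltonian *)

Section hamiltonian_derivative.
Context {R : realType}.
Implicit Types (f g k phi : R -> R) (a b x r s : R) (u v w xi : R -> R[i]).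
Variable p : R.
Hypothesis p1 : 1 < p.

Lemma re_power_nl u x :
  reC (power_nl p u x) = sqnormc (u x) `^ (2^-1 * (p - 1)) * reC (u x).
Proof.
rewrite /power_nl normc_powR; case: (u x) => a b /=.
by rewrite mul0r subr0.
Qed.

Lemma im_power_nl u x :
  imC (power_nl p u x) = sqnormc (u x) `^ (2^-1 * (p - 1)) * imC (u x).
Proof.
rewrite /power_nl normc_powR; case: (u x) => a b /=.
by rewrite mul0r addr0.
Qed.

Lemma measurable_sqnormc u : L2 u -> measurable_fun setT (fun x => sqnormc (u x)).
Proof.
by move=> [ur ui]; apply: measurable_funD; apply: measurable_funX; exact: L2r_meas.
Qed.

Lemma L2_power_nl u : H1 u -> L2 (power_nl p u).
Proof.
move=> Hu; have lu : L2 u by case: Hu.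
have [lr li] := lu.
have [lr1 lr2 lr3] := H1_re Hu; have [li1 li2 li3] := H1_im Hu.
have [Mr Mr0 rM] := rweak_bounded lr1 lr2 lr3.
have [Mi Mi0 iM] := rweak_bounded li1 li2 li3.
have [a [la aM ea]] := bounded_representative Mr0 lr1 rM.
have [b [lb bM eb]] := bounded_representative Mi0 li1 iM.
have ma := L2r_meas la; have mb := L2r_meas lb.
have q0 : 0 <= 2^-1 * (p - 1) by rewrite mulr_ge0// subr_ge0 ltW.
pose m x := (a x ^+ 2 + b x ^+ 2) `^ (2^-1 * (p - 1)).
have mm : measurable_fun setT m.
  apply: (measurableT_comp (measurable_powR _)).
  by apply: measurable_funD; exact: measurable_funX.
have mM x : `|m x| <= (Mr ^+ 2 + Mi ^+ 2) `^ (2^-1 * (p - 1)).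
  rewrite ger0_norm ?powR_ge0//; apply: ge0_ler_powR => //.
  - by rewrite nnegrE addr_ge0 ?sqr_ge0.
  - by rewrite nnegrE addr_ge0 ?sqr_ge0.
  - by rewrite lerD// -[leLHS]real_normK ?num_real// lerXn2r// nnegrE.
have mn : measurable_fun setT (fun x => sqnormc (u x) `^ (2^-1 * (p - 1))).
  by apply: (measurableT_comp (measurable_powR _)); exact: measurable_sqnormc.
split; rewrite /comp.
- apply: (L2r_ae _ _ (L2r_bounded_mul mm mM la)).
    under eq_fun do rewrite re_power_nl.
    by apply: measurable_funM => //; exact: L2r_meas.
  apply: (ae_imp2 ea eb) => x /(_ I) eax /(_ I) ebx _ /=.
  by rewrite re_power_nl /sqnormc /m eax ebx.
- apply: (L2r_ae _ _ (L2r_bounded_mul mm mM lb)).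
    under eq_fun do rewrite im_power_nl.
    by apply: measurable_funM => //; exact: L2r_meas.
  apply: (ae_imp2 ea eb) => x /(_ I) eax /(_ I) ebx _ /=.
  by rewrite im_power_nl /sqnormc /m eax ebx.
Qed.

Lemma hamiltonianE u : hamiltonian p u =
  \int[mu]_x (4^-1 * sqnormc (Dx u x) -
              (p + 1)^-1 * sqnormc (u x) `^ (2^-1 * (p + 1))).
Proof.
congr (Rintegral _ _ _); apply/funext => x.
by rewrite normc_powR normcE sqr_sqrtr// sqnormc_ge0.
Qed.

Lemma rint_comb4 (A B C D : R -> R) a b c d :
  rint A -> rint B -> rint C -> rint D ->
  rint (fun x => a * A x + b * B x + c * C x + d * D x).
Proof.
move=> iA iB iC iD; have := rintZ d iD; have := rintZ c iC.
have := rintZ b iB; have := rintZ a iA => ia ib ic id'.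
exact: (rintD (rintD (rintD ia ib) ic) id').
Qed.

Lemma Rintegral_comb4 (A B C D : R -> R) a b c d :
  rint A -> rint B -> rint C -> rint D ->
  \int[mu]_x (a * A x + b * B x + c * C x + d * D x) =
  a * (\int[mu]_x A x) + b * (\int[mu]_x B x) + c * (\int[mu]_x C x) +
  d * (\int[mu]_x D x).
Proof.
move=> iA iB iC iD; have ia := rintZ a iA; have ib := rintZ b iB.
have ic := rintZ c iC; have id' := rintZ d iD.
have iab := rintD ia ib; have iabc := rintD iab ic.
rewrite (RintegralD _ iabc id')// (RintegralD _ iab ic)// (RintegralD _ ia ib)//.
by rewrite (RintegralZl _ _ iA)// (RintegralZl _ _ iB)// (RintegralZl _ _ iC)//
  (RintegralZl _ _ iD).
Qed.

(** The derivative of the Hamiltonian at u in the direction v,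
    1/2 <Dx u, Dx v> - <|u|^(p-1) u, v>. *)
Definition first_variation u v : R :=
  2^-1 * inner (Dx u) (Dx v) - inner (power_nl p u) v.

Lemma is_derive_hamiltonian u v : H1 u -> H1 v ->
  is_derive (0 : R) 1 (fun s => hamiltonian p (addC_fun u (scaleC_fun s v)))
    (first_variation u v).
Proof.
move=> Hu Hv.
(* bounded representatives of the components, with a common bound M *)
have bounded f g : rH1 f g -> exists2 M, 0 <= M & {ae mu, forall x, `|f x| <= M}.
  by move=> [? ? ?]; exact: (@rweak_bounded _ f g).
have [Ma Ma0 HMa] := bounded _ _ (H1_re Hu).
have [Mb Mb0 HMb] := bounded _ _ (H1_re Hv).
have [Mc Mc0 HMc] := bounded _ _ (H1_im Hu).
have [Md Md0 HMd] := bounded _ _ (H1_im Hv).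
have [lu _] := Hu; have [lv _] := Hv.
have [lur lui] := lu; have [lvr lvi] := lv.
have [a [la aM ea]] := bounded_representative Ma0 lur HMa.
have [b [lb bM eb]] := bounded_representative Mb0 lvr HMb.
have [c [lc cM ec]] := bounded_representative Mc0 lui HMc.
have [d [ld dM ed]] := bounded_representative Md0 lvi HMd.
pose M := Ma + Mb + (Mc + Md).
have {}aM x : `|a x| <= M.
  by rewrite (le_trans (aM x))// /M -!addrA lerDl !addr_ge0.
have {}bM x : `|b x| <= M.
  by rewrite (le_trans (bM x))// /M addrAC lerDr !addr_ge0.
have {}cM x : `|c x| <= M.
  by rewrite (le_trans (cM x))// /M addrCA lerDl !addr_ge0.
have {}dM x : `|d x| <= M.
  by rewrite (le_trans (dM x))// /M addrA lerDr !addr_ge0.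
pose q := 2^-1 * (p + 1).
have q1 : 1 < q by rewrite /q mulrC ltr_pdivlMr// mul1r ltrD2r.
have pp0 : p + 1 != 0 by rewrite gt_eqF// addr_gt0// (lt_trans _ p1).
pose N s x := sqnorm_line (a x) (b x) (c x) (d x) s.
have iN s : rint (fun x => N s x `^ q) :=
  integrable_powR_sqnorm la lb lc ld aM bM cM dM q1 s.
have [lDu _] := H1_Dx Hu; have [lDv _] := H1_Dx Hv.
pose A x := reC (Dx u x) * reC (Dx u x) + imC (Dx u x) * imC (Dx u x).
pose B x := reC (Dx u x) * reC (Dx v x) + imC (Dx u x) * imC (Dx v x).
pose C x := reC (Dx v x) * reC (Dx v x) + imC (Dx v x) * imC (Dx v x).
have iA : rint A by exact: integrable_pairing.
have iB : rint B by exact: integrable_pairing.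
have iC : rint C by exact: integrable_pairing.
have aeN s : {ae mu, forall x, sqnormc (addC_fun u (scaleC_fun s v) x) = N s x}.
  apply: (ae_imp2 (ae_imp2 ea eb (fun x P Q => conj (P I) (Q I)))
    (ae_imp2 ec ed (fun x P Q => conj (P I) (Q I)))) => x /= [eax ebx] [ecx edx].
  by rewrite /sqnormc re_lineE im_lineE eax ebx ecx edx.
(* a quadratic kinetic part in s, and a potential part *)
have HE s : hamiltonian p (addC_fun u (scaleC_fun s v)) =
    (2^-1 * (\int[mu]_x B x) * s + 4^-1 * \int[mu]_x A x) +
    (4^-1 * \int[mu]_x C x) * s ^+ 2 +
    - (p + 1)^-1 * \int[mu]_x (N s x `^ q).
  have Hw := H1_line s Hu Hv; have [lw _] := Hw; have [lDw _] := H1_Dx Hw.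
  rewrite hamiltonianE -/q.
  transitivity (\int[mu]_x (4^-1 * A x + (2^-1 * s) * B x +
      (4^-1 * s ^+ 2) * C x + (- (p + 1)^-1) * (N s x `^ q))); last first.
    rewrite (Rintegral_comb4 _ _ _ _ iA iB iC (iN s)).
    have E (IA IB IC IN pp : R) : 4^-1 * IA + 2^-1 * s * IB +
        4^-1 * s ^+ 2 * IC + pp * IN =
        2^-1 * IB * s + 4^-1 * IA + 4^-1 * IC * s ^+ 2 + pp * IN by ring.
    exact: E.
  apply: eq_Rintegral_ae => //.
  - apply: measurable_funB; apply: measurable_funM => //.
      exact: measurable_sqnormc.
    by apply: (measurableT_comp (measurable_powR _)); exact: measurable_sqnormc.
  - by apply: rint_meas; apply: (rint_comb4 _ _ _ _ iA iB iC (iN s)).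
  - apply: (ae_imp2 (aeN s)
      (Dx_ae Hw (re_line_rH1 s Hu Hv) (im_line_rH1 s Hu Hv))) => x Nx [Dr Di] _.
    rewrite Nx /sqnormc Dr Di /A /B /C.
    have E (ra ia rb ib Ns pp : R) :
        4^-1 * ((ra + s * rb) ^+ 2 + (ia + s * ib) ^+ 2) - pp * Ns =
        4^-1 * (ra * ra + ia * ia) + 2^-1 * s * (ra * rb + ia * ib) +
        4^-1 * s ^+ 2 * (rb * rb + ib * ib) + - pp * Ns by field.
    exact: E.
have dN := is_derive_integral_powR_sqnorm la lb lc ld aM bM cM dM q1.
have -> : (fun s => hamiltonian p (addC_fun u (scaleC_fun s v))) =
    (fun s => (2^-1 * (\int[mu]_x B x) * s + 4^-1 * \int[mu]_x A x) +
    (4^-1 * \int[mu]_x C x) * s ^+ 2 +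
    - (p + 1)^-1 * \int[mu]_x (N s x `^ q)) by apply/funext => s; exact: HE.
have := is_derive_add (is_derive_add
  (is_derive_affine (2^-1 * \int[mu]_x B x) (4^-1 * \int[mu]_x A x) 0)
  (is_derive_mul (is_derive_cst (4^-1 * \int[mu]_x C x) (0 : R) 1)
    (is_derive_expr 2 (is_derive_id (0 : R) 1))))
  (is_derive_mul (is_derive_cst (- (p + 1)^-1) (0 : R) 1) dN).
congr (is_derive _ _ _ _).
rewrite !mul0r !mulr0 mul0r mulr0 !addr0 /first_variation; congr (_ + _).
  by rewrite innerE.
rewrite innerE mulNr; congr (- _).
have iP : rint (fun x => reC (power_nl p u x) * reC (v x) +
    imC (power_nl p u x) * imC (v x)).
  by apply: integrable_pairing => //; exact: L2_power_nl.
have eP : (fun x => reC (power_nl p u x) * reC (v x) +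
    imC (power_nl p u x) * imC (v x)) =
    (fun x => (p + 1)^-1 * (2 * q * (a x ^+ 2 + c x ^+ 2) `^ (q - 1) *
     (a x * b x + c x * d x))) %[ae mu].
  apply: (ae_imp2 (ae_imp2 ea eb (fun x P Q => conj (P I) (Q I)))
    (ae_imp2 ec ed (fun x P Q => conj (P I) (Q I)))) => x /= [eax ebx] [ecx edx] _.
  rewrite re_power_nl im_power_nl /sqnormc eax ebx ecx edx.
  have -> : q - 1 = 2^-1 * (p - 1) by rewrite /q; lra.
  have -> : 2 * q = p + 1 by rewrite /q; field.
  by field.
have mQ : measurable_fun setT (fun x => 2 * q * (a x ^+ 2 + c x ^+ 2) `^ (q - 1) *
     (a x * b x + c x * d x)).
  have [ma mb mc md] := And4 (L2r_meas la) (L2r_meas lb) (L2r_meas lc) (L2r_meas ld).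
  apply: measurable_funM; last by apply: measurable_funD; exact: measurable_funM.
  apply: measurable_funM => //; apply: (measurableT_comp (measurable_powR _)).
  by apply: measurable_funD; exact: measurable_funX.
rewrite (eq_Rintegral_ae _ _ _ eP)//; last 2 first.
- exact: rint_meas.
- exact: measurable_funM.
rewrite RintegralZl//.
have iP' : rint (fun x => (p + 1)^-1 * (2 * q * (a x ^+ 2 + c x ^+ 2) `^ (q - 1) *
     (a x * b x + c x * d x))).
  apply: (@integrable_ae_bound _ _ (fun x => `|reC (power_nl p u x) * reC (v x) +
    imC (power_nl p u x) * imC (v x)|)).
  - exact: measurable_funM.
  - by apply: (ae_imp eP) => x /(_ I) <-.
  - exact: rint_norm.
have := rintZ (p + 1) iP'; congr (_.-integrable _ (_ \o _)).
by apply/funext => x; rewrite mulVKf.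
Qed.

Lemma dHE u v : H1 u -> H1 v -> dH p u v = first_variation u v.
Proof. by move=> Hu Hv; apply: is_derive_derive1; exact: is_derive_hamiltonian. Qed.

End hamiltonian_derivative.

(** * The Hamiltonian vector field and the kernel *)

Section kernel.
Context {R : realType}.
Implicit Types (f g k phi : R -> R) (a b x r s : R) (u v w xi : R -> R[i]).

Lemma omega_integrable u v : L2 u -> L2 v ->
  rint (fun x => imC (u x) * reC (v x) - reC (u x) * imC (v x)).
Proof. by move=> [ur ui] [vr vi]; apply: rintB; exact: L2r_mul. Qed.

Lemma omega_line_l u s v w : L2 u -> L2 v -> L2 w ->
  omega (addC_fun u (scaleC_fun s v)) w = omega u w + s * omega v w.
Proof.
move=> lu lv lw; have iu := omega_integrable lu lw.
have iv := omega_integrable lv lw.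
rewrite !omegaE -RintegralZl// -RintegralD//; last exact: rintZ.
congr (Rintegral _ _ _); apply/funext => x.
by rewrite re_lineE im_lineE; ring.
Qed.

Lemma omega_antisym u v : L2 u -> L2 v -> omega u v = - omega v u.
Proof.
move=> lu lv; rewrite !omegaE -mulN1r -RintegralZl//; last exact: omega_integrable.
by congr (Rintegral _ _ _); apply/funext => x; ring.
Qed.

Lemma omega_line_r u s v w : L2 u -> L2 v -> L2 w ->
  L2 (addC_fun u (scaleC_fun s v)) ->
  omega w (addC_fun u (scaleC_fun s v)) = omega w u + s * omega w v.
Proof.
move=> lu lv lw luv; rewrite omega_antisym// omega_line_l//.
by rewrite (omega_antisym lw lu) (omega_antisym lw lv) mulrN opprD.
Qed.

Lemma omega_ae_r u v w : L2 u -> L2 v -> L2 w -> u = v %[ae mu] ->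
  omega w u = omega w v.
Proof.
move=> lu lv lw uv; rewrite !omegaE; apply: eq_Rintegral_ae => //.
- by apply: rint_meas; exact: omega_integrable.
- by apply: rint_meas; exact: omega_integrable.
- by apply: (ae_imp uv) => x /(_ I) -> _.
Qed.

Lemma L2_scale s u : L2 u -> L2 (scaleC_fun s u).
Proof.
move=> [ur ui]; split; rewrite /comp.
  rewrite (_ : (fun _ => _) = fun x => s * reC (u x)); first exact: L2r_scale.
  by apply/funext => x; rewrite /scaleC_fun; case: (u x) => a b /=; rewrite mul0r subr0.
rewrite (_ : (fun _ => _) = fun x => s * imC (u x)); first exact: L2r_scale.
by apply/funext => x; rewrite /scaleC_fun; case: (u x) => a b /=; rewrite mul0r addr0.
Qed.

Lemma omega_scale_r s u w : L2 u -> L2 w ->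
  omega w (scaleC_fun s u) = s * omega w u.
Proof.
move=> lu lw; rewrite !omegaE -RintegralZl//; last exact: omega_integrable.
congr (Rintegral _ _ _); apply/funext => x; rewrite /scaleC_fun.
by case: (u x) (w x) => a b [c d] /=; ring.
Qed.

Lemma Rintegral_mulr0 f : \int[mu]_x (f x * cst (0 : R) x) = 0.
Proof.
rewrite (_ : (fun _ => _) = cst 0); first by rewrite Rintegral_cst// mul0r.
by apply/funext => x /=; rewrite mulr0.
Qed.

(** The symplectic form is nondegenerate on H^1, since omega(i d, d) is the
    squared norm of d. *)
Lemma omega_nondegenerate d : H1 d -> (forall v, H1 v -> omega v d = 0) ->
  {ae mu, forall x, reC (d x) = 0 /\ imC (d x) = 0}.
Proof.
move=> Hd /(_ _ (H1_mulI Hd)); have [ld _] := Hd.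
have iN := integrable_pairing ld ld.
rewrite omegaE => d0.
have {}d0 : \int[mu]_x (reC (d x) * reC (d x) + imC (d x) * imC (d x)) = 0.
  rewrite -d0; congr (Rintegral _ _ _); apply/funext => x.
  by case: (d x) => a b /=; ring.
have N0 x : 0 <= reC (d x) * reC (d x) + imC (d x) * imC (d x).
  by rewrite -!expr2 addr_ge0// sqr_ge0.
have E0 : (\int[mu]_x `|(reC (d x) * reC (d x) + imC (d x) * imC (d x))%:E| = 0)%E.
  under eq_integral do rewrite gee0_abs ?lee_fin//.
  rewrite -[LHS]fineK; last exact: integrable_fin_num.
  by congr EFin.
have := (ae_eq_integral_abs mu measurableT (measurable_int _ iN)).1 E0.
move=> /ae_imp; apply => x /(_ I) /= [] /eqP.
rewrite -!expr2 paddr_eq0 ?sqr_ge0// !sqrf_eq0 => /andP[/eqP ? /eqP ?].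
by split.
Qed.

Lemma Rintegral_scaleB c f g k : L2r f -> L2r g -> L2r k ->
  \int[mu]_x (c * (f x - g x) * k x) =
  c * (\int[mu]_x (f x * k x) - \int[mu]_x (g x * k x)).
Proof.
move=> lf lg lk; have i1 := L2r_mul lf lk; have i2 := L2r_mul lg lk.
rewrite -RintegralB// -RintegralZl//; last exact: rintB.
by congr (Rintegral _ _ _); apply/funext => x; ring.
Qed.

Lemma Rintegral_scaleD c f g k : L2r f -> L2r g -> L2r k ->
  \int[mu]_x (c * (f x + g x) * k x) =
  c * (\int[mu]_x (f x * k x) + \int[mu]_x (g x * k x)).
Proof.
move=> lf lg lk; have i1 := L2r_mul lf lk; have i2 := L2r_mul lg lk.
rewrite -RintegralD// -RintegralZl//; last exact: rintD.
by congr (Rintegral _ _ _); apply/funext => x; ring.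
Qed.

Variable p : R.
Hypothesis p1 : 1 < p.

(** With [P = |u|^(p-1) u], the equation [i xi = - 1/2 u'' - P] of
    distributions says that [Dx u] has weak derivative [- 2 (i xi + P)]. *)
Lemma eq_distr_XiP u xi : H1 u -> H1 xi ->
  eq_distr (distr xi) (Xi_H_distr p u) <->
  rweak (fun x => reC (Dx u x)) (fun x => 2 * (imC (xi x) - reC (power_nl p u x)))
  /\ rweak (fun x => imC (Dx u x))
    (fun x => - 2 * (reC (xi x) + imC (power_nl p u x))).
Proof.
move=> Hu Hxi; have [lDu wDu] := H1_Dx Hu; have [[lxr lxi] _] := Hxi.
have [lPr lPi] := L2_power_nl p1 Hu.
have [/weak_derivativeP[wr wi]] := conj wDu I => _.
have i0 : (iC : R[i]) != 0 by rewrite eq_complex/= oner_eq0 andbF.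
pose Q phi : R[i] :=
  (2^-1 * (\int[mu]_x (reC (Dx u x) * derive1 phi x)) -
    \int[mu]_x (reC (power_nl p u x) * phi x)) +i*
  (2^-1 * (\int[mu]_x (imC (Dx u x) * derive1 phi x)) -
    \int[mu]_x (imC (power_nl p u x) * phi x)).
have QE phi : test_function phi -> nls_rhs p u phi = Q phi.
  move=> tphi; have tphi' := test_derive1 tphi.
  rewrite /nls_rhs {1}/Ddistr wDu// !distrE /Q.
  by apply/eqP; rewrite eq_complex/=; apply/andP; split; apply/eqP; ring.
have EQ phi : test_function phi ->
  (distr xi phi = Xi_H_distr p u phi) <->
  (- (\int[mu]_x (imC (xi x) * phi x)) = reC (Q phi) /\
   \int[mu]_x (reC (xi x) * phi x) = imC (Q phi)).
  move=> tphi; rewrite /Xi_H_distr QE//.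
  have -> : (distr xi phi = iC^-1 * Q phi) <-> (iC * distr xi phi = Q phi).
    by split=> [->|<-]; rewrite ?mulKf ?mulVKf.
  rewrite distrE; move: (Q phi) => [X Y] /=; split.
    by rewrite /iC => -[<- <-]; split; ring.
  by move=> [<- <-]; apply/eqP; rewrite eq_complex/=; apply/andP; split;
    apply/eqP; ring.
have RE phi : test_function phi ->
    \int[mu]_x (2 * (imC (xi x) - reC (power_nl p u x)) * phi x) =
    2 * (\int[mu]_x (imC (xi x) * phi x) -
      \int[mu]_x (reC (power_nl p u x) * phi x)).
  by move=> tphi; apply: Rintegral_scaleB => //; exact: test_L2r.
have IE phi : test_function phi ->
    \int[mu]_x (- 2 * (reC (xi x) + imC (power_nl p u x)) * phi x) =
    - 2 * (\int[mu]_x (reC (xi x) * phi x) +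
      \int[mu]_x (imC (power_nl p u x) * phi x)).
  by move=> tphi; apply: Rintegral_scaleD => //; exact: test_L2r.
split=> [H|[Hr Hi] phi tphi].
  split=> phi tphi; have /(EQ _ tphi)[/= Er Ei] := H phi tphi.
    by rewrite RE//; lra.
  by rewrite IE//; lra.
apply/EQ => //=; have := Hr phi tphi; have := Hi phi tphi.
by rewrite RE// IE//; split; lra.
Qed.

(** The pairing with [Dx v] can be computed with any weak derivative of v. *)
Lemma inner_Dx w v f g : L2 w -> H1 v ->
  rH1 (fun x => reC (v x)) f -> rH1 (fun x => imC (v x)) g ->
  inner w (Dx v) = \int[mu]_x (reC (w x) * f x) + \int[mu]_x (imC (w x) * g x).
Proof.
move=> lw Hv Hf Hg; have [lwr lwi] := lw.
have [_ lf _] := Hf; have [_ lg _] := Hg; have [lDv _] := H1_Dx Hv.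
have i1 : rint (fun x => reC (w x) * f x) by exact: L2r_mul.
have i2 : rint (fun x => imC (w x) * g x) by exact: L2r_mul.
rewrite innerE -RintegralD//; apply: eq_Rintegral_ae => //.
- by apply: rint_meas; exact: integrable_pairing.
- by apply: rint_meas; exact: rintD.
- by apply: (ae_imp (Dx_ae Hv Hf Hg)) => x [-> ->] _.
Qed.

(** The weak form of the equation, against all of H^1, is equivalent to its
    distributional form: integrate by parts in one direction, test against
    [phi] and [i phi] in the other. *)
Lemma first_variation_distr u xi : H1 u -> H1 xi ->
  (forall v, H1 v -> omega v xi = first_variation p u v) <->
  eq_distr (distr xi) (Xi_H_distr p u).
Proof.
move=> Hu Hxi; have [lDu wDu] := H1_Dx Hu; have [lxi _] := Hxi.
have lP := L2_power_nl p1 Hu.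
have [lDur lDui] := lDu; have [lxr lxim] := lxi; have [lPr lPi] := lP.
have lwr : L2r (fun x => 2 * (imC (xi x) - reC (power_nl p u x))).
  by apply: L2r_scale; apply: L2r_add => //; exact: L2r_opp.
have lwi : L2r (fun x => - 2 * (reC (xi x) + imC (power_nl p u x))).
  by apply: L2r_scale; exact: L2r_add.
apply: iff_trans (iff_sym (eq_distr_XiP Hu Hxi)).
split=> [H|[Hr Hi] v Hv].
- split=> phi tphi; have lphi := test_L2r tphi.
  + rewrite Rintegral_scaleB//; have Hv := H1_real tphi; have := H _ Hv.
    rewrite /first_variation (inner_Dx lDu Hv (rH1_test tphi) rH1_cst0).
    have -> : omega (fun x => (phi x)%:C) xi = - \int[mu]_x (imC (xi x) * phi x).
      rewrite omegaE -mulN1r -RintegralZl//; last exact: L2r_mul.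
      by congr (Rintegral _ _ _); apply/funext => x /=; ring.
    have -> : inner (power_nl p u) (fun x => (phi x)%:C) =
        \int[mu]_x (reC (power_nl p u x) * phi x).
      by rewrite innerE; congr (Rintegral _ _ _); apply/funext => x /=; ring.
    by rewrite Rintegral_mulr0; lra.
  + rewrite Rintegral_scaleD//.
    have Hv : H1 (fun x => 0 +i* phi x).
      by apply: (@H1I _ _ (cst 0) (derive1 phi)); [exact: rH1_cst0|exact: rH1_test].
    have := H _ Hv.
    rewrite /first_variation (inner_Dx lDu Hv rH1_cst0 (rH1_test tphi)).
    have -> : omega (fun x => 0 +i* phi x) xi = \int[mu]_x (reC (xi x) * phi x).
      by rewrite omegaE; congr (Rintegral _ _ _); apply/funext => x /=; ring.
    have -> : inner (power_nl p u) (fun x => 0 +i* phi x) =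
        \int[mu]_x (imC (power_nl p u x) * phi x).
      by rewrite innerE; congr (Rintegral _ _ _); apply/funext => x /=; ring.
    by rewrite Rintegral_mulr0; lra.
- have [lvr lDvr wvr] := H1_re Hv; have [lvi lDvi wvi] := H1_im Hv.
  have Pr := rweak_parts lDur lwr Hr lvr lDvr wvr.
  have Pi := rweak_parts lDui lwi Hi lvi lDvi wvi.
  move: Pr Pi; rewrite Rintegral_scaleB// Rintegral_scaleD// => Pr Pi.
  rewrite /first_variation !innerE omegaE.
  rewrite RintegralB//; [|exact: L2r_mul..].
  rewrite (RintegralD measurableT (L2r_mul lDur lDvr) (L2r_mul lDui lDvi)).
  rewrite (RintegralD measurableT (L2r_mul lPr lvr) (L2r_mul lPi lvi)).
  rewrite Pr Pi.
  have C f g : \int[mu]_x (f x * g x) = \int[mu]_x (g x * f x).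
    by congr (Rintegral _ _ _); apply/funext => x; rewrite mulrC.
  rewrite [\int[mu]_x (imC (v x) * _)]C [\int[mu]_x (reC (v x) * _)]C.
  by field.
Qed.

Lemma is_Xi_H_distr u xi : H1 u -> H1 xi ->
  is_Xi_H p u xi <-> eq_distr (distr xi) (Xi_H_distr p u).
Proof.
move=> Hu Hxi; apply: iff_trans (first_variation_distr Hu Hxi).
split=> [[_ H] v Hv|H]; first by rewrite -(dHE p1 Hu Hv) H.
by split=> // v Hv; rewrite (dHE p1 Hu Hv) H.
Qed.

(** ** The form on the extended phase space *)

Lemma derive1_alpha (z w1 w2 : (R -> R[i]) * R) : Vt z -> Vt w1 -> Vt w2 ->
  derive1 (fun s => alpha p (translate z s w1) w2) 0 =
  2^-1 * omega w1.1 w2.1 - dH p z.1 w1.1 * w2.2.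
Proof.
move=> Hz H1' H2'; have [[lz _] [l1 _] [l2 _]] := And3 Hz H1' H2'.
have E s : alpha p (translate z s w1) w2 =
    (2^-1 * omega w1.1 w2.1) * s + 2^-1 * omega z.1 w2.1 +
    - w2.2 * hamiltonian p (addC_fun z.1 (scaleC_fun s w1.1)).
  by rewrite /alpha /translate /= omega_line_l//; ring.
rewrite (_ : (fun s => _) = (fun s => (2^-1 * omega w1.1 w2.1) * s +
    2^-1 * omega z.1 w2.1 +
    - w2.2 * hamiltonian p (addC_fun z.1 (scaleC_fun s w1.1)))); last first.
  by apply/funext => s; exact: E.
rewrite dHE//; apply: is_derive_derive1.
have := is_derive_add (is_derive_affine (2^-1 * omega w1.1 w2.1) (2^-1 * omega z.1 w2.1) 0)
  (is_derive_mul (is_derive_cst (- w2.2) (0 : R) 1) (is_derive_hamiltonian p1 Hz H1')).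
congr (is_derive _ _ _ _); rewrite /=.
by move: (hamiltonian _ _) (first_variation _ _ _) => h f; ring.
Qed.

Lemma omegatE (z w1 w2 : (R -> R[i]) * R) : Vt z -> Vt w1 -> Vt w2 ->
  omegat p z w1 w2 =
  omega w1.1 w2.1 - dH p z.1 w1.1 * w2.2 + dH p z.1 w2.1 * w1.2.
Proof.
move=> Hz H1' H2'; have [[l1 _] [l2 _]] := conj H1' H2'.
rewrite /omegat /ext_deriv !derive1_alpha// (omega_antisym l2 l1).
have E (o x y : R) : 2^-1 * o - x - (2^-1 * - o - y) = o - x + y by field.
exact: E.
Qed.

(** Pairing with the directions (v, 0), which leave t fixed, says in weak form
    that w = (w1, T) in the kernel satisfies w1 = T Xi_H. *)
Lemma ker_omegat_vertical u (t : R) (w : (R -> R[i]) * R) : H1 u ->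
  ker_omegat p (u, t) w -> forall v, H1 v -> omega v w.1 = w.2 * dH p u v.
Proof.
move=> Hu [Hw H] v Hv; have [[lw _] [lv _]] := conj Hw Hv.
have Hv0 : Vt (v, 0 : R) by exact: Hv.
have Hz : Vt (u, t) by exact: Hu.
have := H _ Hv0; rewrite (omegatE Hz Hw Hv0) (omega_antisym lw lv).
have E (o x y c : R) : - o - x * 0 + y * c = 0 -> o = c * y.
  by move=> /eqP; rewrite mulr0 subr0 addrC subr_eq0 mulrC => /eqP.
exact: E.
Qed.

Lemma omega_eq_scale_ae u xi a : H1 u -> H1 xi ->
  (forall v, H1 v -> omega v u = a * omega v xi) ->
  u = scaleC_fun a xi %[ae mu].
Proof.
move=> Hu Hxi H; have [[lu _] [lxi _]] := conj Hu Hxi.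
have Hd := H1_line (- a) Hu Hxi; have [ld _] := Hd.
have : {ae mu, forall x, reC (addC_fun u (scaleC_fun (- a) xi) x) = 0 /\
    imC (addC_fun u (scaleC_fun (- a) xi) x) = 0}.
  apply: omega_nondegenerate => // v Hv; have [lv _] := Hv.
  by rewrite omega_line_r// H// mulNr subrr.
move=> /ae_imp; apply => x; rewrite re_lineE im_lineE => -[Er Ei] _.
move: Er Ei; rewrite /scaleC_fun; case: (u x) (xi x) => ur ui [xr xm] /= Er Ei.
by apply/eqP; rewrite eq_complex/=; apply/andP; split; apply/eqP; lra.
Qed.

(** The kernel at a point where the Hamiltonian vector field is defined. *)
Lemma ker_omegatP u (t : R) xi (w : (R -> R[i]) * R) : H1 u -> is_Xi_H p u xi -> Vt w ->
  ker_omegat p (u, t) w <-> w.1 = scaleC_fun w.2 xi %[ae mu].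
Proof.
move=> Hu [Hxi HX] Hw; have [[lw _] [lxi _]] := conj Hw Hxi.
have Hz : Vt (u, t) by exact: Hu.
split=> [H|H].
- apply: omega_eq_scale_ae => // v Hv.
  by rewrite (ker_omegat_vertical Hu H Hv) HX.
- split=> // w' Hw'; have [lw' _] := Hw'.
  have E v : L2 v -> omega v w.1 = w.2 * omega v xi.
    by move=> lv; rewrite (omega_ae_r lw (L2_scale w.2 lxi) lv H) omega_scale_r.
  have xx0 : omega xi xi = 0.
    have F0 (o : R) : o = - o -> o = 0 by move=> oN; lra.
    exact/F0/omega_antisym.
  rewrite (omegatE Hz Hw Hw') -(HX _ Hw) -(HX _ Hw') (omega_antisym lw lw').
  rewrite (E _ lw') (omega_antisym lw lxi) (E _ lxi) xx0.
  have F (x y c : R) : - (y * x) - - (y * 0) * c + x * y = 0 by ring.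
  exact: F.
Qed.

Lemma ker_omegat1P u (t : R) xi : H1 u -> H1 xi ->
  ker_omegat p (u, t) (xi, 1) <-> is_Xi_H p u xi.
Proof.
move=> Hu Hxi; have Hw : Vt (xi, 1 : R) by exact: Hxi.
split=> [H|HX].
  split=> // v Hv.
  by have := ker_omegat_vertical Hu H Hv; rewrite mul1r.
apply/(ker_omegatP _ Hu HX Hw) => /=; rewrite (_ : scaleC_fun 1 xi = xi).
  exact: aeW.
by apply/funext => x; rewrite /scaleC_fun mul1r.
Qed.

Lemma ker_omegat_line u (t : R) xi : H1 u -> is_Xi_H p u xi ->
  ker_omegat p (u, t) = real_line (xi, 1).
Proof.
move=> Hu HX; apply/seteqP; split=> [w Kw|w [Hw [a Ha wa]]].
  have Hw : Vt w by case: Kw.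
  split=> //; exists w.2; last by rewrite mulr1.
  exact/(ker_omegatP t Hu HX Hw).
apply/(ker_omegatP t Hu HX Hw).
by rewrite wa mulr1.
Qed.

Lemma eq_distr_nlsP u xi :
  eq_distr (fun phi => iC * distr xi phi) (nls_rhs p u) <->
  eq_distr (distr xi) (Xi_H_distr p u).
Proof.
have i0 : (iC : R[i]) != 0 by rewrite eq_complex/= oner_eq0 andbF.
split=> H phi tphi; have := H phi tphi; rewrite /Xi_H_distr.
  by move=> <-; rewrite mulKf.
by move=> ->; rewrite mulVKf.
Qed.

End kernel.

Theorem proposition1 (R : realType) (p : R) (p_gt1 : 1 < p) :
  (forall (I : set R) (u du : R -> R -> R[i]),
     open I -> is_interval I -> C1_curve I u du ->
     (nls_solution p I u du <->
      forall t, I t -> ker_omegat p (u t, t) (du t, 1)))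
  /\
  (forall (u : R -> R[i]) (t : R) (xi : R -> R[i]), H1 u -> H1 xi ->
     (is_Xi_H p u xi <-> eq_distr (distr xi) (Xi_H_distr p u)) /\
     (is_Xi_H p u xi -> ker_omegat p (u, t) = real_line (xi, 1))).
Proof.
split=> [I u du _ _ [Hu Hdu _ _]|u t xi Hu Hxi]; last first.
  by split; [exact: is_Xi_H_distr|exact: ker_omegat_line].
have E t : I t -> eq_distr (fun phi => iC * distr (du t) phi) (nls_rhs p (u t))
    <-> ker_omegat p (u t, t) (du t, 1).
  move=> It; have Hut := Hu t It; have Hdut := Hdu t It.
  apply: iff_trans (iff_sym (ker_omegat1P p_gt1 t Hut Hdut)).
  exact: (iff_trans (eq_distr_nlsP _ _ _) (iff_sym (is_Xi_H_distr p_gt1 Hut Hdut))).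
by split=> H t It; apply/(E t It); exact: H.
Qed.
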